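(* Let $n\ge 1$, $p\ge 1$ and let $C_1,\ldots,C_{p+1}\subset GL(n,{\bf C})$ be conjugacy classes; set $d_j=\dim C_j$. Consider the variety $${\cal V}=\{(M_1,\ldots,M_{p+1})~|~M_j\in C_j,~M_1\cdots M_{p+1}=I\}.$$ At every point $(M_1,\ldots,M_{p+1})\in{\cal V}$ whose centralizer is trivial, the variety ${\cal V}$ is smooth and of dimension $d_1+\cdots+d_{p+1}-n^2+1$.
   Context: The centralizer of a $(p+1)$-tuple of $n\times n$ matrices is the set of matrices commuting with all matrices of the tuple; it is called trivial if it consists only of scalar matrices. Dimensions are complex dimensions. *)

(* Defs.v *)
From HB Require Import structures.
From mathcomp Require Import all_boot all_order all_algebra.
From mathcomp Require Import all_classical all_reals all_analysis.

Set Implicit Arguments.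
Unset Strict Implicit.
Unset Printing Implicit Defensive.

Import Order.TTheory GRing.Theory Num.Theory.
Import numFieldNormedType.Exports.

Local Open Scope classical_set_scope.
Local Open Scope ring_scope.

(* K stands for the complex field: it is R[i], for R : realType, wherever these
   definitions are used.  (They are stated for a numFieldType because that is
   where the library puts the normed topology.)  Differentiability is always
   over K, so over R[i] it is complex (Frechet) differentiability, and a
   function differentiable at every point of an open set is holomorphic there. *)

Definition biholomorphic (K : numFieldType) (m n m' n' : nat)
    (U : set 'M[K]_(m, n)) (W : set 'M[K]_(m', n'))
    (phi : 'M[K]_(m, n) -> 'M[K]_(m', n'))
    (psi : 'M[K]_(m', n') -> 'M[K]_(m, n)) : Prop :=
  [/\ open U, open W,
      phi @` U = W /\ (forall u, U u -> psi (phi u) = u),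
      (forall u, U u -> differentiable phi u) &
      (forall w, W w -> differentiable psi w)].

(* K^k x {0} inside K^N. *)
Definition coord_subspace (K : numFieldType) (N k : nat) : set 'rV[K]_N :=
  [set y | forall i : 'I_N, (k <= i)%N -> y 0 i = 0].

(* S is smooth and of (complex) dimension k at its point x: near x it is a
   complex submanifold of dimension k of the ambient affine space, i.e. some
   holomorphic chart of the ambient space straightens S to K^k x {0}. *)
Definition smooth_at (K : numFieldType) (m n : nat) (S : set 'M[K]_(m, n))
    (x : 'M[K]_(m, n)) (k : nat) : Prop :=
  S x /\ (k <= m * n)%N /\
  exists (U : set 'M[K]_(m, n)) (W : set 'rV[K]_(m * n))
         (phi : 'M[K]_(m, n) -> 'rV[K]_(m * n))
         (psi : 'rV[K]_(m * n) -> 'M[K]_(m, n)),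
    [/\ U x, biholomorphic U W phi psi &
        phi @` (S `&` U) = W `&` @coord_subspace K (m * n) k].

(* As usual for analytic sets, the largest dimension at a smooth point
   (and 0 if there is no such point). *)
Definition cdim (K : numFieldType) (m n : nat) (S : set 'M[K]_(m, n)) : nat :=
  \max_(k < (m * n).+1 | `[< exists x, smooth_at S x k >]) k.

Definition conjugacy_class (K : numFieldType) (n : nat) (A : 'M[K]_n)
    : set 'M[K]_n :=
  [set X | exists2 g, g \in unitmx & X = g *m A *m invmx g].

Definition is_GL_conjugacy_class (K : numFieldType) (n : nat)
    (C : set 'M[K]_n) : Prop :=
  exists2 A : 'M[K]_n, A \in unitmx & C = conjugacy_class A.

Definition trivial_centralizer (K : numFieldType) (n p : nat)
    (M : 'I_p.+1 -> 'M[K]_n) : Prop :=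
  forall X : 'M[K]_n,
    (forall j, X *m M j = M j *m X) -> exists a : K, X = a%:M.

Definition variety (K : numFieldType) (n p : nat)
    (C : 'I_p.+1 -> set 'M[K]_n) : set ('I_p.+1 -> 'M[K]_n) :=
  [set M | (forall j, C j (M j)) /\
           \big[mulmx/1%:M]_(j < p.+1) M j = 1%:M].

(* The identification of (M_n)^(p+1) with the coordinate space
   K^((p+1) n^2): row j of the matrix lists the entries of M_j. *)
Definition tuple_mx (K : numFieldType) (n p : nat)
    (M : 'I_p.+1 -> 'M[K]_n) : 'M[K]_(p.+1, n * n) :=
  \matrix_(j < p.+1) mxvec (M j).

(* Main.v *)
(* Near M, the variety is the zero set of a map with surjective derivative, so that the
   inverse function theorem, obtained by Newton iteration on R[i]-matrices, straightens it.
   Locally the class of A is cut out by n^2 - d equations with d = rank (X |-> X A - A X),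
   and the relation M_1 ... M_{p+1} = I by its n^2 - 1 components modulo scalar matrices:
   in the product of the C_j the determinant of the product is 1, hence a scalar product is
   an n-th root of unity, equal to 1 near M. A linear relation between the derivatives is a
   matrix Y with tr Y = 0 which, tested on the tangent vectors X M_j - M_j X, commutes with
   all M_j; a trivial centralizer forces Y scalar, so Y = 0. *)
Require Import Defs.
From HB Require Import structures.
From mathcomp Require Import all_boot all_order all_algebra.
From mathcomp Require Import complex.
From mathcomp Require Import all_classical all_reals all_analysis.
From mathcomp Require Import zify ring lra.
Import Order.TTheory GRing.Theory Num.Theory.
Import numFieldNormedType.Exports.
Local Open Scope classical_set_scope.
Local Open Scope ring_scope.

Set Implicit Arguments.
Unset Strict Implicit.
Unset Printing Implicit Defensive.

(** Along the product of the classes the determinant of M_1 ... M_{p+1} is constant, so at a point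
    of the variety its derivative has trace 0 there: with all n^2 components of the relation the
    derivative would never be surjective. This is why one component is given up and then recovered
    from the roots of unity, and it is the origin of the +1 in the dimension.

    A chart must be differentiable on an open set in both directions, not only at its centre. The
    equations are therefore polynomial in the entries, adjugates standing in for inverses, so that
    they have a strict derivative at every point.

    The numbers d_j are defined as maxima over charts of C_j. Equating d_j with a rank thus needs
    two more facts: charts at one point have the same dimension, and the rank is constant along a
    class. *)

Section RealNorm.
Variable R : realType.
Notation K := R[i].

(** Norms over [R[i]] take values in [R[i]], whose order is partial. They are real, so the real part
    loses nothing ([nRE]) and estimates become inequalities in the ordered field [R], within reach
    of [lra]. *)
Definition nR (V : normedZmodType K) (v : V) : R := complex.Re `|v|.

(** * Real-valued norms of vectors and matrices over the complex field *)

Section General.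
Variable V : normedZmodType K.
Implicit Types u v w : V.

Lemma nRE v : `|v| = (nR v)%:C%C.
Proof. by rewrite /nR RRe_real // normr_real. Qed.

Lemma nR_ge0 v : 0 <= nR v.
Proof. by have := normr_ge0 v; rewrite nRE ler0c. Qed.

Lemma nR0 : nR (0 : V) = 0.
Proof. by rewrite /nR normr0. Qed.

Lemma nR_eq0 v : nR v = 0 -> v = 0.
Proof. by move=> h; apply/normr0_eq0; rewrite nRE h. Qed.

Lemma nRN v : nR (- v) = nR v.
Proof. by rewrite /nR normrN. Qed.

Lemma nRB u v : nR (u - v) = nR (v - u).
Proof. by rewrite -nRN opprB. Qed.

Lemma nRD u v : nR (u + v) <= nR u + nR v.
Proof. by have := ler_normD u v; rewrite !nRE -rmorphD lecR. Qed.

Lemma nRD3 w u v : nR (u - v) <= nR (u - w) + nR (w - v).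
Proof. by apply: le_trans (nRD _ _); rewrite addrA subrK. Qed.

Lemma nR_sum (I : Type) (r : seq I) (P : pred I) (F : I -> V) :
  nR (\sum_(i <- r | P i) F i) <= \sum_(i <- r | P i) nR (F i).
Proof.
elim/big_rec2: _ => [|i a b _ h]; first by rewrite nR0.
by apply: le_trans (nRD _ _) _; rewrite lerD2l.
Qed.

End General.

Lemma nRM (a b : K) : nR (a * b) = nR a * nR b.
Proof.
by apply: (@complexI R); rewrite rmorphM /= -!nRE normrM.
Qed.

Lemma nR_real (a : R) : nR (a%:C%C : K) = `|a|.
Proof. by rewrite /nR normc_def /= expr0n /= addr0 sqrtr_sqr. Qed.

Lemma nR_i : nR ('i%C : K) = 1.
Proof. by rewrite /nR normc_def /= expr0n /= add0r expr1n sqrtr1. Qed.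

Lemma nR_Re (z : K) : `|complex.Re z| <= nR z.
Proof. by have := normc_ge_Re z; rewrite nRE lecR. Qed.

Lemma nR_Im (z : K) : `|complex.Im z| <= nR z.
Proof.
have := nR_Re (z * 'i%C); rewrite nRM nR_i mulr1.
by case: z => a b /=; rewrite mulr0 mulr1 sub0r normrN.
Qed.

Lemma nR_leReIm (z : K) : nR z <= `|complex.Re z| + `|complex.Im z|.
Proof.
have {1}-> : z = (complex.Re z)%:C%C + (complex.Im z)%:C%C * 'i%C.
  by rewrite mulrC -complexE.
apply: le_trans (nRD _ _) _; rewrite nRM !nR_real.
by rewrite nR_i mulr1.
Qed.

Lemma nR_entry m n (u : 'M[K]_(m, n)) i j : nR (u i j) <= nR u.
Proof.
rewrite -lecR -!nRE; rewrite [`|u|]mx_normE.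
set x := (X in _ <= X%:num).
have h : (widen_itv `|u i j|%:itv : {nonneg K}) <= x.
  by apply: (@le_bigmax _ _ _ _
    (fun p : 'I_m * 'I_n => widen_itv `|u p.1 p.2|%:itv : {nonneg K}) (i, j)).
by move: h; rewrite -num_le.
Qed.

Lemma nR_mxle m n (u : 'M[K]_(m, n)) (e : R) : 0 <= e -> (forall i j, nR (u i j) <= e) -> nR u <= e.
Proof.
move=> e0 h; have [u0|] := eqVneq (mx_norm u) 0.
  by rewrite (_ : nR u = 0) // /nR [`|u|]u0.
move=> /mx_norm_neq0 [[i j] /= hij].
by rewrite /nR [`|u|]hij; exact: h.
Qed.

Lemma nR_mxZ m n (a : K) (u : 'M[K]_(m, n)) : nR (a *: u) = nR a * nR u.
Proof.
by apply: (@complexI R); rewrite rmorphM /= -!nRE normrZ.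
Qed.

Lemma nR_mxvec m n (u : 'M[K]_(m, n)) : nR (mxvec u) = nR u.
Proof.
apply/eqP; rewrite eq_le; apply/andP; split; apply: nR_mxle; rewrite ?nR_ge0 //.
  by move=> i k; case/mxvec_indexP: k => a b; rewrite ord1 mxvecE nR_entry.
by move=> i j; rewrite -mxvecE nR_entry.
Qed.

Lemma nR_mulmx m n q (u : 'M[K]_(m, n)) (J : 'M[K]_(n, q)) : nR (u *m J) <= nR u * (n%:R * nR J).
Proof.
apply: nR_mxle => [|i j]; first by rewrite !mulr_ge0 ?nR_ge0.
rewrite mxE; apply: le_trans (nR_sum _ _ _) _.
rewrite mulrA [_ * n%:R]mulrC -mulrA -[n in n%:R]card_ord mulr_natl -sumr_const.
by apply: ler_sum => k _; rewrite nRM ler_pM ?nR_ge0 ?nR_entry.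
Qed.

Lemma nR_vec_mx m n (v : 'rV[K]_(m * n)) : nR (vec_mx v) = nR v.
Proof. by rewrite -nR_mxvec vec_mxK. Qed.

(** * Completeness: limits of sequences with geometrically decreasing steps *)

Lemma real_seq_limit (a : nat -> R) (c : R) :
  (forall k, `|a k.+1 - a k| <= c / 2 ^+ k) ->
  exists l, forall k, `|a k - l| <= 2 * c / 2 ^+ k.
Proof.
move=> h.
(* [e k] is the sum of all step bounds from index [k] on, so the intervals from [a k - e k] to
   [a k + e k] are nested. The supremum of the left ends lies in all of them. *)
pose e k := 2 * c / 2 ^+ k.
have eS k : e k = e k.+1 + c / 2 ^+ k.
  rewrite /e exprS invfM; have : 2 ^+ k != 0 :> R by rewrite expf_neq0.
  by move=> ?; field.
have e0 k : 0 <= e k.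
  have := le_trans (normr_ge0 _) (h k); rewrite /e -mulrA => ?.
  by rewrite mulr_ge0.
have lo k d : a k - e k <= a (k + d)%N - e (k + d)%N.
  elim: d => [|d ih]; first by rewrite addn0.
  apply: (le_trans ih); rewrite addnS (eS (k + d)%N).
  by have := h (k + d)%N; rewrite ler_norml => /andP[? _]; lra.
have up k d : a (k + d)%N + e (k + d)%N <= a k + e k.
  elim: d => [|d ih]; first by rewrite addn0.
  apply: (le_trans _ ih); rewrite addnS (eS (k + d)%N).
  by have := h (k + d)%N; rewrite ler_norml => /andP[_ ?]; lra.
have lu k j : a k - e k <= a j + e j.
  have := lo k j; have := up j k; rewrite addnC => h1 h2.
  by have := e0 (k + j)%N; lra.
pose S := [set x | exists k, x = a k - e k].
have ubS k : ubound S (a k + e k) by move=> _ [j ->].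
have nS : S !=set0 by exists (a 0%N - e 0%N); exists 0%N.
exists (sup S) => k; rewrite distrC ler_norml; apply/andP; split.
  have : a k - e k <= sup S.
    by apply: ub_le_sup; [exists (a k + e k)| exists k].
  by rewrite /e; lra.
have : sup S <= a k + e k by apply: ge_sup.
by rewrite /e; lra.
Qed.

(** The constant doubles because the errors of the real and imaginary parts are added. *)
Lemma complex_seq_limit (a : nat -> K) (c : R) :
  (forall k, nR (a k.+1 - a k) <= c / 2 ^+ k) ->
  exists l, forall k, nR (a k - l) <= 4 * c / 2 ^+ k.
Proof.
move=> h.
have ReB (x y : K) : complex.Re (x - y) = complex.Re x - complex.Re y.
  by case: x; case: y.
have ImB (x y : K) : complex.Im (x - y) = complex.Im x - complex.Im y.
  by case: x; case: y.
have [x hx] := @real_seq_limit (fun k => complex.Re (a k)) c (fun k =>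
  le_trans (eq_ind _ (fun t => `|t| <= _) (nR_Re _) _ (ReB _ _)) (h k)).
have [y hy] := @real_seq_limit (fun k => complex.Im (a k)) c (fun k =>
  le_trans (eq_ind _ (fun t => `|t| <= _) (nR_Im _) _ (ImB _ _)) (h k)).
exists (Complex x y) => k; apply: le_trans (nR_leReIm _) _.
rewrite ReB ImB /=; have := hx k; have := hy k; move: (_ / _) => /=.
have -> : 4 * c / 2 ^+ k = 2 * c / 2 ^+ k + 2 * c / 2 ^+ k by lra.
by move=> *; apply: lerD.
Qed.

Lemma matrix_seq_limit m n (a : nat -> 'M[K]_(m, n)) (c : R) :
  (forall k, nR (a k.+1 - a k) <= c / 2 ^+ k) ->
  exists l, forall k, nR (a k - l) <= 4 * c / 2 ^+ k.
Proof.
move=> h.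
have hij i j : exists l, forall k, nR (a k i j - l) <= 4 * c / 2 ^+ k.
  apply: complex_seq_limit => k; apply: le_trans (h k).
  by apply: le_trans (nR_entry _ i j); rewrite !mxE.
exists (\matrix_(i, j) sval (cid (hij i j))) => k; apply: nR_mxle.
  have := le_trans (nR_ge0 _) (h k); move: (2 ^+ k) => t ?.
  by rewrite -mulrA mulr_ge0.
by move=> i j; rewrite !mxE; case: cid => l /= ->.
Qed.

End RealNorm.

(** * Strict derivatives and their calculus *)

Section StrictDerivative.
Variable R : realType.
Notation K := R[i].

Definition near2 (N : nat) (x : 'rV[K]_N) (P : 'rV[K]_N -> 'rV[K]_N -> Prop) :=
  exists2 d : R, 0 < d & forall u v, nR (u - x) < d -> nR (v - x) < d -> P u v.

Section Near2.
Variables (N : nat) (x : 'rV[K]_N).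
Implicit Types P Q : 'rV[K]_N -> 'rV[K]_N -> Prop.

Lemma near2_imp P Q : (forall u v, P u v -> Q u v) -> near2 x P -> near2 x Q.
Proof. by move=> h [d d0 hd]; exists d => // u v hu hv; apply: h; exact: hd. Qed.

Lemma near2_and P Q : near2 x P -> near2 x Q -> near2 x (fun u v => P u v /\ Q u v).
Proof.
move=> [d d0 hd] [e e0 he]; exists (Num.min d e); first by rewrite lt_min d0.
move=> u v; rewrite !lt_min => /andP[u1 u2] /andP[v1 v2].
by split; [exact: hd | exact: he].
Qed.

Lemma near2_forall (I : finType) (P : I -> 'rV[K]_N -> 'rV[K]_N -> Prop) :
  (forall i, near2 x (P i)) -> near2 x (fun u v => forall i, P i u v).
Proof.
move=> h.
have hs (s : seq I) : near2 x (fun u v => forall i, i \in s -> P i u v).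
  elim: s => [|i s ih]; first by exists 1.
  apply: near2_imp (near2_and (h i) ih) => u v [h1 h2] j.
  by rewrite inE => /predU1P [->|/h2].
by apply: near2_imp (hs (enum I)) => u v hi i; apply: hi; rewrite mem_enum.
Qed.

Lemma near2_ball (e : R) : 0 < e ->
  near2 x (fun u v => nR (u - x) < e /\ nR (v - x) < e).
Proof. by move=> e0; exists e. Qed.

Lemma near2_swap P : near2 x P -> near2 x (fun u v => P v u).
Proof. by move=> [d d0 h]; exists d => // u v hu hv; exact: h. Qed.

Lemma near2_x P : near2 x P -> near2 x (fun u _ => P u x).
Proof. by move=> [d d0 h]; exists d => // u v hu _; apply: h; rewrite ?subrr ?nR0. Qed.

End Near2.

Lemma addmxE a b (A B : 'M[K]_(a, b)) i j : (A + B) i j = A i j + B i j.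
Proof. by rewrite mxE. Qed.

Lemma oppmxE a b (A : 'M[K]_(a, b)) i j : (- A) i j = - A i j.
Proof. by rewrite mxE. Qed.

Lemma scalemxE a b c (A : 'M[K]_(a, b)) i j : (c *: A) i j = c * A i j.
Proof. by rewrite mxE. Qed.

(* Strict derivatives: as both points vary, subtracting the derivative leaves a
   contraction near [x], without any mean value inequality. *)
Definition sderiv (N q : nat) (F : 'rV[K]_N -> 'rV[K]_q) (x : 'rV[K]_N)
    (J : 'M[K]_(N, q)) :=
  forall e : R, 0 < e ->
  near2 x (fun u v => nR (F u - F v - (u - v) *m J) <= e * nR (u - v)).

(** The scalar case is where the product rule is proved; matrix-valued maps are then treated entry
    by entry. *)
Definition sderiv1 (N : nat) (f : 'rV[K]_N -> K) (x : 'rV[K]_N) (J : 'cV[K]_N) :=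
  forall e : R, 0 < e ->
  near2 x (fun u v => nR (f u - f v - ((u - v) *m J) 0 0) <= e * nR (u - v)).

Lemma sderiv_rows N q (F : 'rV[K]_N -> 'rV[K]_q) x (J : 'I_q -> 'cV[K]_N) :
  (forall j, sderiv1 (fun u => F u 0 j) x (J j)) ->
  sderiv F x (\matrix_(i, j) J j i 0).
Proof.
move=> h e e0; apply: near2_imp (near2_forall (fun j => h j e e0)) => u v hj.
apply: nR_mxle => [|i j]; first by rewrite mulr_ge0 ?nR_ge0 ?ltW.
rewrite ord1; apply: le_trans (hj j); rewrite !mxE le_eqVlt; apply/orP; left.
by apply/eqP; congr (nR (_ - _)); apply: eq_bigr => k _; rewrite !mxE.
Qed.

Lemma sderiv_mulmx N q r (F : 'rV[K]_N -> 'rV[K]_q) x J (B : 'M[K]_(q, r)) :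
  sderiv F x J -> sderiv (fun u => F u *m B) x (J *m B).
Proof.
move=> h e e0.
(* A bound for the operator norm of [B], increased by 1 so that it can be divided by even when
   [B = 0]. The same device recurs below. *)
set c : R := q%:R * nR B + 1.
have c0 : 0 < c by rewrite ltr_wpDl // mulr_ge0 ?nR_ge0.
apply: near2_imp (h (e / c) (divr_gt0 e0 c0)) => u v hu.
rewrite mulmxA -!mulmxBl; apply: le_trans (nR_mulmx _ _) _.
apply: (@le_trans _ _ (nR (F u - F v - (u - v) *m J) * c)).
  by apply: ler_wpM2l; rewrite ?nR_ge0 // /c lerDl.
apply: le_trans (ler_wpM2r (ltW c0) hu) _.
by rewrite mulrAC divfK // gt_eqF.
Qed.

Lemma sderivD N q (F G : 'rV[K]_N -> 'rV[K]_q) x J J' :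
  sderiv F x J -> sderiv G x J' -> sderiv (fun u => F u + G u) x (J + J').
Proof.
move=> hF hG e e0; have e2 : 0 < e / 2 by apply: divr_gt0.
apply: near2_imp (near2_and (hF _ e2) (hG _ e2)) => u v [h1 h2].
rewrite mulmxDr.
have -> : F u + G u - (F v + G v) - ((u - v) *m J + (u - v) *m J') =
  (F u - F v - (u - v) *m J) + (G u - G v - (u - v) *m J').
  by rewrite (addrACA (F u - F v)) -!opprD (addrACA (F u)) -opprD.
apply: le_trans (nRD _ _) _; lra.
Qed.

Lemma sderiv_affine N q x y (J : 'M[K]_(N, q)) :
  sderiv (fun u => (u - y) *m J) x J.
Proof.
move=> e e0; exists 1 => // u v _ _.
by rewrite -!mulmxBl [- (v - y)]opprB addrA subrK subrr mul0mx nR0 mulr_ge0 ?nR_ge0 ?ltW.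
Qed.

Section Scalar.
Variables (N : nat) (x : 'rV[K]_N).
Implicit Types (f g : 'rV[K]_N -> K) (J : 'cV[K]_N).

Lemma nR_functional (h : 'rV[K]_N) J :
  nR ((h *m J) 0 0) <= (N%:R * nR J) * nR h.
Proof.
by apply: le_trans (nR_entry _ _ _) _; rewrite mulrC; exact: nR_mulmx.
Qed.

Lemma sderiv1_eq f g J : (forall u, f u = g u) -> sderiv1 f x J -> sderiv1 g x J.
Proof. by move=> h; rewrite (_ : f = g) //; apply/funext. Qed.

Lemma sderiv1_continuous f J (e : R) : sderiv1 f x J -> 0 < e ->
  near2 x (fun u _ => nR (f u - f x) <= e).
Proof.
move=> hf e0.
set c : R := N%:R * nR J + 1.
have c0 : 0 < c by rewrite ltr_wpDl // mulr_ge0 ?nR_ge0.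
have := near2_and (near2_x (hf 1 ltr01)) (@near2_ball _ x (e / c) (divr_gt0 e0 c0)).
apply: near2_imp => u v [h1 [h2 _]].
have h3 := nR_functional (u - x) J.
have : nR (f u - f x) <= c * nR (u - x).
  rewrite -[f u - f x](subrK (((u - x) *m J) 0 0)).
  by apply: le_trans (nRD _ _) _; rewrite /c mulrDl addrC lerD.
move/le_trans; apply.
by rewrite mulrC -ler_pdivlMr // ltW.
Qed.

Lemma sderiv1_cst (a : K) : sderiv1 (fun _ => a) x 0.
Proof.
move=> e e0; exists 1 => // u v _ _.
by rewrite mulmx0 subrr mxE subr0 nR0 mulr_ge0 ?nR_ge0 ?ltW.
Qed.

Lemma sderiv1D f g J J' : sderiv1 f x J -> sderiv1 g x J' ->
  sderiv1 (fun u => f u + g u) x (J + J').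
Proof.
move=> hF hG e e0; have e2 : 0 < e / 2 by apply: divr_gt0.
apply: near2_imp (near2_and (hF _ e2) (hG _ e2)) => u v [h1 h2].
rewrite mulmxDr addmxE.
have -> : f u + g u - (f v + g v) - (((u - v) *m J) 0 0 + ((u - v) *m J') 0 0) =
  (f u - f v - ((u - v) *m J) 0 0) + (g u - g v - ((u - v) *m J') 0 0) by ring.
apply: le_trans (nRD _ _) _; lra.
Qed.

Lemma sderiv1M f g J J' : sderiv1 f x J -> sderiv1 g x J' ->
  sderiv1 (fun u => f u * g u) x (g x *: J + f x *: J').
Proof.
move=> hf hg e e0.
(* Near [x], [A] bounds [g u], [f v] and both derivatives; its summand 1 absorbs the variation of
   [f] and [g], which is at most [t <= 1]. The error splits into four terms, each at most
   [t * A * nR (u - v)], whence the factor 4 in the choice of [t]. *)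
set A : R := 1 + nR (f x) + nR (g x) + N%:R * nR J + N%:R * nR J'.
have a1 := nR_ge0 (f x); have a2 := nR_ge0 (g x).
have a3 : 0 <= N%:R * nR J by rewrite mulr_ge0 ?nR_ge0.
have a4 : 0 <= N%:R * nR J' by rewrite mulr_ge0 ?nR_ge0.
have A0 : 0 < A by rewrite /A; lra.
set t := Num.min 1 (e / (4 * A)).
have t0 : 0 < t by rewrite lt_min ltr01 divr_gt0 // mulr_gt0.
have t1 : t <= 1 by rewrite ge_min lexx.
have tA : 4 * (t * A) <= e.
  have : t <= e / (4 * A) by rewrite ge_min lexx orbT.
  by rewrite ler_pdivlMr ?mulr_gt0 //; lra.
have := near2_and (near2_and (hf t t0) (hg t t0)) (near2_and
  (near2_swap (sderiv1_continuous hf t0)) (sderiv1_continuous hg t0)).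
apply: near2_imp => u v [[h1 h2] [h3 h4]].
rewrite mulmxDr -!scalemxAr addmxE !scalemxE.
set a := ((u - v) *m J) 0 0 in h1 *; set b := ((u - v) *m J') 0 0 in h2 *.
have ha : nR a <= (N%:R * nR J) * nR (u - v) := nR_functional _ _.
have hb : nR b <= (N%:R * nR J') * nR (u - v) := nR_functional _ _.
have -> : f u * g u - f v * g v - (g x * a + f x * b) =
  (f u - f v - a) * g u + f v * (g u - g v - b) + a * (g u - g x)
  + (f v - f x) * b by ring.
have hh := nR_ge0 (u - v).
have gu : nR (g u) <= A.
  have := nRD (g x) (g u - g x); rewrite subrKC /A; lra.
have fv : nR (f v) <= A.
  have := nRD (f x) (f v - f x); rewrite subrKC /A; lra.
have aA : nR a <= A * nR (u - v).
  by apply: (le_trans ha); apply: ler_wpM2r => //; rewrite /A; lra.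
have bA : nR b <= A * nR (u - v).
  by apply: (le_trans hb); apply: ler_wpM2r => //; rewrite /A; lra.
have k1 : nR ((f u - f v - a) * g u) <= t * A * nR (u - v).
  by rewrite nRM mulrAC; apply: ler_pM; rewrite ?nR_ge0.
have k2 : nR (f v * (g u - g v - b)) <= t * A * nR (u - v).
  by rewrite nRM [t * A]mulrC -mulrA; apply: ler_pM; rewrite ?nR_ge0.
have k3 : nR (a * (g u - g x)) <= t * A * nR (u - v).
  by rewrite nRM mulrC -mulrA; apply: ler_pM; rewrite ?nR_ge0.
have k4 : nR ((f v - f x) * b) <= t * A * nR (u - v).
  by rewrite nRM -mulrA; apply: ler_pM; rewrite ?nR_ge0.
apply: (@le_trans _ _ (4 * (t * A) * nR (u - v))); last exact: ler_wpM2r.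
have := nRD ((f u - f v - a) * g u) (f v * (g u - g v - b)).
have := nRD ((f u - f v - a) * g u + f v * (g u - g v - b)) (a * (g u - g x)).
have := nRD ((f u - f v - a) * g u + f v * (g u - g v - b) + a * (g u - g x))
  ((f v - f x) * b).
by move: k1 k2 k3 k4; rewrite -[4 * (t * A) * _]mulrA; lra.
Qed.

Lemma sderiv1_linear f J : (forall u, f u = (u *m J) 0 0) -> sderiv1 f x J.
Proof.
move=> h e e0; exists 1 => // u v _ _.
rewrite !h mulmxBl addmxE oppmxE subrr nR0.
by rewrite mulr_ge0 ?nR_ge0 ?ltW.
Qed.

End Scalar.

(** The derivative is a function of the increment rather than a matrix, so that the Leibniz rule
    keeps its form in matrix products; the columns [J] force it to be linear. *)
Definition mderiv (N a b : nat) (f : 'rV[K]_N -> 'M[K]_(a, b)) (x : 'rV[K]_N)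
    (D : 'rV[K]_N -> 'M[K]_(a, b)) :=
  forall i j, exists2 J : 'cV[K]_N, sderiv1 (fun u => f u i j) x J &
    forall h, D h i j = (h *m J) 0 0.

Definition smooth_mx (N a b : nat) (f : 'rV[K]_N -> 'M[K]_(a, b)) :=
  forall x, exists D, mderiv f x D.

Definition smooth1 (N : nat) (f : 'rV[K]_N -> K) :=
  forall x, exists J, sderiv1 f x J.

Section Calculus.
Variable N : nat.

Lemma smooth1_eq (f g : 'rV[K]_N -> K) : (forall u, f u = g u) -> smooth1 f -> smooth1 g.
Proof. by move=> h; rewrite (_ : f = g) //; apply/funext. Qed.

Lemma smooth1_cst (a : K) : @smooth1 N (fun _ => a).
Proof. by move=> x; exists 0; exact: sderiv1_cst. Qed.

Lemma smooth1_sum (I : Type) (r : seq I) (P : pred I) (F : I -> 'rV[K]_N -> K) :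
  (forall i, smooth1 (F i)) -> smooth1 (fun u => \sum_(i <- r | P i) F i u).
Proof.
move=> h; elim: r => [|i r ih].
  by apply: smooth1_eq (smooth1_cst 0) => u; rewrite big_nil.
have [Pi|nPi] := boolP (P i); last first.
  by apply: smooth1_eq ih => u; rewrite big_cons (negbTE nPi).
move=> x; have [J1 h1] := h i x; have [J2 h2] := ih x.
exists (J1 + J2); apply: sderiv1_eq (sderiv1D h1 h2) => u.
by rewrite big_cons Pi.
Qed.

Lemma smooth1M (f g : 'rV[K]_N -> K) :
  smooth1 f -> smooth1 g -> smooth1 (fun u => f u * g u).
Proof.
by move=> hf hg x; have [J1 h1] := hf x; have [J2 h2] := hg x; eexists; exact: sderiv1M h1 h2.
Qed.

Lemma smooth1_prod (I : Type) (r : seq I) (P : pred I) (F : I -> 'rV[K]_N -> K) :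
  (forall i, smooth1 (F i)) -> smooth1 (fun u => \prod_(i <- r | P i) F i u).
Proof.
move=> h; elim: r => [|i r ih].
  by apply: smooth1_eq (smooth1_cst 1) => u; rewrite big_nil.
have [Pi|nPi] := boolP (P i); last first.
  by apply: smooth1_eq ih => u; rewrite big_cons (negbTE nPi).
by apply: smooth1_eq (smooth1M (h i) ih) => u; rewrite big_cons Pi.
Qed.

Lemma smooth_mxP a b (f : 'rV[K]_N -> 'M[K]_(a, b)) :
  smooth_mx f <-> forall i j, smooth1 (fun u => f u i j).
Proof.
split=> [h i j x|h x].
  by have [D /(_ i j) [J hJ _]] := h x; exists J.
exists (fun y => \matrix_(i, j) (y *m sval (cid (h i j x))) 0 0) => i j.
exists (sval (cid (h i j x))); first exact: svalP (cid _).
by move=> y; rewrite mxE.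
Qed.

Lemma smooth_det a (f : 'rV[K]_N -> 'M[K]_a) :
  smooth_mx f -> smooth1 (fun u => \det (f u)).
Proof.
move=> /smooth_mxP h; apply: smooth1_sum => s; apply: smooth1M.
  exact: smooth1_cst.
by apply: smooth1_prod => i.
Qed.

Lemma smooth_adj a (f : 'rV[K]_N -> 'M[K]_a) :
  smooth_mx f -> smooth_mx (fun u => \adj (f u)).
Proof.
move=> /smooth_mxP h; apply/smooth_mxP => i j.
apply: (@smooth1_eq (fun u => (-1) ^+ (j + i) * \det (row' j (col' i (f u))))).
  by move=> u; rewrite mxE.
apply: smooth1M; first exact: smooth1_cst.
apply: smooth_det; apply/smooth_mxP => k l.
by apply: smooth1_eq (h (lift j k) (lift i l)) => u; rewrite !mxE.
Qed.

Lemma mderiv_mulmx a b c (f : 'rV[K]_N -> 'M[K]_(a, b)) (g : 'rV[K]_N -> 'M[K]_(b, c))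
    x D D' : mderiv f x D -> mderiv g x D' ->
  mderiv (fun u => f u *m g u) x (fun h => D h *m g x + f x *m D' h).
Proof.
move=> hf hg i j.
have hs (s : seq 'I_b) : exists2 J : 'cV[K]_N,
    sderiv1 (fun u => \sum_(k <- s) f u i k * g u k j) x J &
    forall h, \sum_(k <- s) (D h i k * g x k j + f x i k * D' h k j) = (h *m J) 0 0.
  elim: s => [|k s [J h1 h2]].
    exists 0; first by apply: sderiv1_eq (sderiv1_cst _ 0) => u; rewrite big_nil.
    by move=> h; rewrite big_nil mulmx0 mxE.
  have [J1 k1 e1] := hf i k; have [J2 k2 e2] := hg k j.
  exists ((g x k j *: J1 + f x i k *: J2) + J).
    by apply: sderiv1_eq (sderiv1D (sderiv1M k1 k2) h1) => u; rewrite big_cons.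
  move=> h; rewrite big_cons h2 e1 e2 !mulmxDr -!scalemxAr !addmxE !scalemxE.
  by rewrite [_ * g x k j]mulrC.
have [J h1 h2] := hs (index_enum 'I_b).
exists J; first by apply: sderiv1_eq h1 => u; rewrite !mxE.
by move=> h; rewrite -h2 !mxE big_split.
Qed.

Lemma mderivD a b (f g : 'rV[K]_N -> 'M[K]_(a, b)) x D D' :
  mderiv f x D -> mderiv g x D' ->
  mderiv (fun u => f u + g u) x (fun h => D h + D' h).
Proof.
move=> hf hg i j; have [J1 k1 e1] := hf i j; have [J2 k2 e2] := hg i j.
exists (J1 + J2); first by apply: sderiv1_eq (sderiv1D k1 k2) => u; rewrite mxE.
by move=> h; rewrite mulmxDr !mxE e1 e2 !mxE.
Qed.

Lemma mderiv_cst a b (A : 'M[K]_(a, b)) x : mderiv (fun _ : 'rV[K]_N => A) x (fun _ => 0).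
Proof.
move=> i j; exists 0; first exact: sderiv1_cst.
by move=> h; rewrite mulmx0 !mxE.
Qed.

Lemma mderiv_linear a b (L : {linear 'rV[K]_N -> 'M[K]_(a, b)}) x : mderiv L x L.
Proof.
move=> i j.
have hL u : L u i j = (u *m \col_k L (delta_mx 0 k) i j) 0 0.
  rewrite {1}[u]row_sum_delta linear_sum summxE mxE; apply: eq_bigr => k _.
  by rewrite linearZ !mxE.
by eexists; [exact: sderiv1_linear hL|].
Qed.

Lemma mderiv_mull a b c (A : 'M[K]_(c, a)) (f : 'rV[K]_N -> 'M[K]_(a, b)) x D :
  mderiv f x D -> mderiv (fun u => A *m f u) x (fun h => A *m D h).
Proof.
move=> hf i j; have [J h1 h2] := mderiv_mulmx (mderiv_cst A x) hf i j.
by exists J => // h; rewrite -h2 mul0mx add0r.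
Qed.

Lemma mderiv_mulr a b c (f : 'rV[K]_N -> 'M[K]_(a, b)) (A : 'M[K]_(b, c)) x D :
  mderiv f x D -> mderiv (fun u => f u *m A) x (fun h => D h *m A).
Proof.
move=> hf i j; have [J h1 h2] := mderiv_mulmx hf (mderiv_cst A x) i j.
by exists J => // h; rewrite -h2 mulmx0 addr0.
Qed.

Lemma mderiv_eq a b (f g : 'rV[K]_N -> 'M[K]_(a, b)) x D D' :
  f =1 g -> D =1 D' -> mderiv f x D -> mderiv g x D'.
Proof.
by move=> /funext -> /funext ->.
Qed.

Lemma mderiv_sderiv q (F : 'rV[K]_N -> 'rV[K]_q) x D : mderiv F x D ->
  exists2 J, sderiv F x J & forall h, D h = h *m J.
Proof.
move=> hF; pose J j := s2val (cid2 (hF 0 j)).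
exists (\matrix_(i, j) J j i 0).
  by apply: sderiv_rows => j; exact: s2valP (cid2 _).
move=> h; apply/rowP => j; rewrite (s2valP' (cid2 (hF 0 j)) h) -/(J j) !mxE.
by apply: eq_bigr => k _; rewrite !mxE.
Qed.

End Calculus.

End StrictDerivative.

(* The matrix topology is found over a numFieldType only, not over [R[i]]. *)
Notation openK := (@open ('M[_[i]]_(_, _) : normedModType _[i])).

(** * The inverse function theorem over the complex field *)

Section InverseFunction.
Variable R : realType.
Notation K := R[i].

(** The bound on [L] gives the continuity that [differentiable] demands of the differential. *)
Definition frechet (V W : normedModType K) (f : V -> W) (x : V)
    (L : {linear V -> W}) :=
  (exists c : R, forall h, nR (L h) <= c * nR h) /\
  forall e : R, 0 < e ->
  exists2 d, 0 < d & forall u, nR (u - x) < d ->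
    nR (f u - f x - L (u - x)) <= e * nR (u - x).

(* Abstracting the norms first spares [lra] costly conversions between them. *)
Ltac nlra := repeat match goal with
  | |- context [@nR ?T ?V ?a] => move: (@nR T V a) => ?
  end; lra.

(** With [a = h u], [c = h x] and [b] the target value, this splits the displacement of a Newton
    iterate from the centre into a contracted part and a constant one. *)
Lemma newton_step (F : comNzRingType) N (u a b c x : 'rV[F]_N) :
  u - (a - b) - x = - (a - c - (u - x)) + (b - c).
Proof. by apply/rowP => i; rewrite !mxE; ring. Qed.

Lemma newton_diff (F : comNzRingType) N (u v a b c : 'rV[F]_N) :
  u - (a - c) - (v - (b - c)) = - (a - b - (u - v)).
Proof. by apply/rowP => i; rewrite !mxE; ring. Qed.

Lemma gt0_complexP (e : K) : 0 < e -> exists2 r : R, 0 < r & e = r%:C%C.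
Proof.
by case: e => a b; rewrite ltcE /= => /andP[/eqP -> a0]; exists a.
Qed.

Lemma nbhs_nRP (V : normedModType K) (x : V) (P : set V) :
  nbhs x P <-> exists2 d : R, 0 < d & forall u, nR (u - x) < d -> P u.
Proof.
split.
  move=> /nbhs_ballP [e /= /gt0_complexP [r r0 ->] h]; exists r => // u hu.
  by apply: h; rewrite -ball_normE /= distrC nRE ltcR.
move=> [d d0 h]; apply/nbhs_ballP; exists d%:C%C; first by rewrite /= ltcR.
by move=> u; rewrite -ball_normE /= distrC nRE ltcR => /h.
Qed.

Lemma open_nR (V : normedModType K) (A : set V) :
  (forall u, A u -> exists2 d : R, 0 < d & forall v, nR (v - u) < d -> A v) ->
  open A.
Proof. by move=> h; rewrite openE => u /h /nbhs_nRP. Qed.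

Lemma frechet_differentiable (V W : normedModType K) (f : V -> W) x L :
  frechet f x L -> differentiable f x.
Proof.
move=> [[c hc] h].
have cL : continuous L.
  apply/linear_bounded_continuous; rewrite /bounded_near.
  near=> M; apply/nbhs_nRP; exists 1 => // u; rewrite subr0 => u1.
  have hu := hc u; rewrite /= nRE.
  have hM : (`|c|%:C%C : K) <= M by near: M; apply: nbhs_pinfty_ge; rewrite complex_real.
  apply: le_trans hM; rewrite lecR; apply: (le_trans hu).
  have := ler_norm c; have := nR_ge0 u; have := normr_ge0 c; nra.
have hL : f \o shift x = cst (f x) + L +o_0 id.
  apply/eqaddoP => e /gt0_complexP [r r0 ->].
  have [d d0 hd] := h r r0.
  apply/nbhs_nRP; exists d => // u; rewrite subr0 => hu.
  rewrite !nRE -rmorphM lecR /=.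
  have := hd (u + x); rewrite addrK => /(_ hu).
  by rewrite /= !fctE opprD addrA.
by apply/diff_locallyP; rewrite (diff_unique cL hL).
Unshelve. all: by end_near. Qed.

Lemma le_half_pow (a c : R) : (forall k, a <= c / 2 ^+ k) -> a <= 0.
Proof.
move=> h; rewrite leNgt; apply/negP => a0.
have c0 : 0 <= c by have := h 0%N; rewrite expr0 divr1; lra.
set k := Num.bound (c / a).
have := h k; rewrite ler_pdivlMr ?exprn_gt0 // leNgt => /negP; apply.
rewrite mulrC -ltr_pdivrMr //.
apply: (@lt_le_trans _ _ k%:R); first by apply: archi_boundP; rewrite divr_ge0 // ltW.
by rewrite -natrX ler_nat ltnW // ltn_expl.
Qed.

Section Local.
Variables (N : nat) (g : 'rV[K]_N -> 'rV[K]_N) (x : 'rV[K]_N) (J0 : 'M[K]_N).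
Hypothesis gJ : forall u, exists J, sderiv g u J.
Hypothesis J0u : J0 \in unitmx.

(** Normalized to have the identity as derivative at [x]; [hd] below then says that [h] minus the
    identity halves distances. *)
Let h u := g u *m invmx J0.
Let c : R := N%:R * nR (invmx J0) + 1.

Local Lemma c_gt0 : 0 < c.
Proof. by rewrite ltr_wpDl // mulr_ge0 ?nR_ge0. Qed.

Local Lemma h_le (y z : 'rV[K]_N) :
  nR (y *m invmx J0 - z *m invmx J0) <= c * nR (y - z).
Proof.
rewrite -mulmxBl; apply: le_trans (nR_mulmx _ _) _; rewrite mulrC.
by apply: ler_wpM2r; rewrite ?nR_ge0 // lerDl.
Qed.

Variable d : R.
Hypothesis d0 : 0 < d.
Hypothesis hd : forall u v, nR (u - x) < d -> nR (v - x) < d ->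
  nR (h u - h v - (u - v)) <= 2^-1 * nR (u - v).

(** With radius [d / 4] an iterate at distance at most [d / 2] from [x] is followed by one at
    distance at most [d / 4 + d / 4], so the iteration never leaves the domain of [hd]. *)
Let W := [set y : 'rV[K]_N | nR (y *m invmx J0 - h x) < d / 4].
Let U := [set u | nR (u - x) < d /\ W (g u)].

Local Lemma h_expand u v : nR (u - x) < d -> nR (v - x) < d ->
  nR (u - v) <= 2 * nR (h u - h v).
Proof.
have dp := d0.
move=> hu hv; have := hd hu hv.
have := nRD3 (h u - h v) (u - v) 0; rewrite !subr0 [nR (u - v - _)]nRB; lra.
Qed.

Local Lemma h_lip u v : nR (u - x) < d -> nR (v - x) < d ->
  nR (h u - h v) <= 2 * nR (u - v).
Proof.
have dp := d0.
move=> hu hv; have := hd hu hv.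
have := nRD3 (u - v) (h u - h v) 0; rewrite !subr0; have := nR_ge0 (u - v); lra.
Qed.

Local Lemma h_surj y : W y -> exists2 u, U u & g u = y.
Proof.
have dp := d0.
(* Newton's map with the derivative frozen at [x]: its fixed points are the solutions, and by [hd]
   it halves distances. *)
move=> Wy; pose T u := u - (h u - y *m invmx J0).
pose a k := iter k T x.
have TB u : T u - x = - (h u - h x - (u - x)) + (y *m invmx J0 - h x).
  exact: newton_step.
have aB k : nR (a k - x) <= d / 2.
  elim: k => [|k ih]; first by rewrite subrr nR0 divr_ge0 // ltW.
  rewrite /a iterS TB; apply: le_trans (nRD _ _) _; rewrite nRN.
  have ak : nR (a k - x) < d. by lra.
  have := @hd (a k) x ak; rewrite (subrr x) nR0 => /(_ d0) h1.
  move: Wy; rewrite /W /= -/(a k) => ?; lra.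
have aB' k : nR (a k - x) < d by have := aB k; lra.
have aS k : nR (a k.+1 - a k) <= (d / 4) / 2 ^+ k.
  elim: k => [|k ih].
    rewrite expr0 divr1 /a /= /T opprB [x + _]addrC addrK ltW //.
  have -> : a k.+2 - a k.+1 = - (h (a k.+1) - h (a k) - (a k.+1 - a k)).
    exact: (newton_diff (a k.+1) (a k)).
  rewrite nRN; apply: le_trans (hd (aB' _) (aB' _)) _.
  rewrite exprS invfM mulrCA; apply: ler_wpM2l => //; lra.
have [l hl] := matrix_seq_limit aS.
have hl' k : nR (a k - l) <= d / 2 ^+ k.
  by apply: le_trans (hl k) _; rewrite le_eqVlt; apply/orP; left; apply/eqP; congr (_ / _); field.
(* The limit must lie strictly inside the ball: index 2 gives [d / 4 + d / 2]. *)
have lx : nR (l - x) < d.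
  have := nRD3 (a 2) l x; rewrite [nR (l - a 2)]nRB; have := aB 2; have := hl' 2.
  rewrite (_ : 2 ^+ 2 = 4); [lra | ring].
(* The residual of [a k] is the step [a k - a k.+1], which tends to 0, and [h] is Lipschitz on the
   ball. *)
have E : h l = y *m invmx J0.
  apply/subr0_eq/nR_eq0/le_anti; rewrite nR_ge0 andbT.
  apply: (@le_half_pow _ (2 * d + d / 4)) => k.
  apply: le_trans (nRD3 (h (a k)) _ _) _; rewrite mulrDl; apply: lerD.
    apply: le_trans (h_lip lx (aB' k)) _; rewrite -mulrA; apply: ler_wpM2l => //.
    by rewrite nRB; exact: hl'.
  apply: le_trans (aS k); rewrite nRB /a iterS -/(a k) /T.
  by rewrite [a k - _]addrC addrK opprB.
have gl : g l = y by rewrite -[g l](mulmxKV J0u) -/(h l) E mulmxKV.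
by exists l => //; split => //; rewrite gl.
Qed.

(** The default value [x] is taken only outside [W], by [h_surj]. *)
Let psi y := xget x [set u | U u /\ g u = y].

Local Lemma U_inj u v : U u -> U v -> g u = g v -> u = v.
Proof.
move=> [hu _] [hv _] e; apply/subr0_eq/nR_eq0/le_anti; rewrite nR_ge0 andbT.
by apply: le_trans (h_expand hu hv) _; rewrite /h e subrr nR0 mulr0.
Qed.

Local Lemma psiP y : W y -> U (psi y) /\ g (psi y) = y.
Proof.
move=> /h_surj [u Uu e]; rewrite /psi; case: xgetP => [v _ //|/(_ u) []//].
Qed.

Local Lemma psiK u : U u -> psi (g u) = u.
Proof.
move=> Uu; have Wu : W (g u) by case: Uu.
by have [h1 h2] := psiP Wu; apply: U_inj.
Qed.

Local Lemma W_ball y : W y -> exists2 r : R, 0 < r & forall v, nR (v - y) < r -> W v.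
Proof.
have dp := d0.
rewrite /W /= => Wy.
exists ((d / 4 - nR (y *m invmx J0 - h x)) / c); first by rewrite divr_gt0 ?c_gt0 // subr_gt0.
move=> v; rewrite ltr_pdivlMr ?c_gt0 // => hv.
have := h_le v y; have := nRD3 (y *m invmx J0) (v *m invmx J0) (h x).
by move: hv; rewrite [_ * c]mulrC; nlra.
Qed.

Local Lemma openW : openK W.
Proof. by apply: open_nR => y /W_ball. Qed.

Local Lemma openU : openK U.
Proof.
have dp := d0.
apply: open_nR => u [] hu; rewrite /W /= => Wu.
pose t := d / 4 - nR (h u - h x).
have t0 : 0 < t by rewrite subr_gt0.
exists (Num.min (d - nR (u - x)) (t / 2)); first by rewrite lt_min subr_gt0 hu divr_gt0.
move=> v; rewrite lt_min => /andP[h1 h2].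
have hv : nR (v - x) < d by have := nRD3 u v x; lra.
split; first exact: hv.
have := h_lip hv hu; change (nR (h v - h u) <= 2 * nR (v - u) -> nR (h v - h x) < d / 4).
move: h2 (nRD3 (h u) (h v) (h x)); rewrite /t.
by move: (h u) (h v) (h x) => p q r; nlra.
Qed.

Local Lemma Ux : U x.
Proof. by split; rewrite /W /= subrr nR0 ?divr_gt0. Qed.

(** Along a vector killed by [J] the map [g] would be flat to first order, whereas [h_expand]
    forbids it to shrink distances much. The tolerance [1 / (4 * c)] turns this into
    [nR (w - u) <= nR (w - u) / 2]; the factor [s] makes the step from [u] to [w] half as long as
    allowed. *)
Local Lemma J_unit u J : U u -> sderiv g u J -> J \in unitmx.
Proof.
have dp := d0.
move=> [hu _] hJ; rewrite -row_free_unit -kermx_eq0; apply/eqP/row_matrixP => i.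
have : row i (kermx J) *m J = 0 by rewrite -row_mul mulmx_ker row0.
rewrite row0; move: (row i _) => v vJ.
have c0 := c_gt0.
have [e e0 he] := hJ (1 / (4 * c)) (divr_gt0 ltr01 (mulr_gt0 (ltr0n _ 4) c0)).
apply: nR_eq0; apply/eqP; rewrite eq_le nR_ge0 andbT leNgt; apply/negP => v0.
set s := Num.min e (d - nR (u - x)) / (2 * nR v).
have m0 : 0 < Num.min e (d - nR (u - x)) by rewrite lt_min e0 subr_gt0.
have s0 : 0 < s by rewrite divr_gt0 // mulr_gt0.
pose w := u + s%:C%C *: v.
have wE : w - u = s%:C%C *: v by rewrite /w [u + _]addrC addrK.
have wJ : (w - u) *m J = 0 by rewrite wE -scalemxAl vJ scaler0.
have wu : nR (w - u) = s * nR v by rewrite wE nR_mxZ nR_real gtr0_norm.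
have ws : nR (w - u) < Num.min e (d - nR (u - x)).
  rewrite wu /s invfM mulrA divfK ?gt_eqF //; lra.
move: (ws); rewrite lt_min => /andP[w1 w2].
have hw : nR (w - x) < d by have := nRD3 u w x; lra.
have h1 := h_expand hw hu.
have := he w u w1; rewrite (subrr u) nR0 => /(_ e0); rewrite wJ subr0 => h2.
have h3 := h_le (g w) (g u).
have : nR (w - u) <= 2 * (c * (1 / (4 * c) * nR (w - u))).
  apply: (le_trans h1); apply: ler_wpM2l => //; apply: (le_trans h3).
  by apply: ler_wpM2l => //; rewrite ltW.
have -> : 2 * (c * (1 / (4 * c) * nR (w - u))) = nR (w - u) / 2.
  by field; rewrite gt_eqF.
have : 0 < nR (w - u) by rewrite wu mulr_gt0.
by nlra.
Qed.

Local Lemma g_frechet u J : sderiv g u J -> frechet g u (mulmxr J).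
Proof.
move=> hJ; split; first by exists (N%:R * nR J) => v; rewrite mulrC; exact: nR_mulmx.
by move=> e /hJ [t t0 ht]; exists t => // v hv; apply: ht => //; rewrite subrr nR0.
Qed.

Local Lemma psi_frechet w : W w -> exists L, frechet psi w L.
Proof.
have dp := d0.
move=> Ww; have [u psiw] : exists u, psi w = u by exists (psi w).
have [] := psiP Ww; rewrite psiw => Uu gu.
have [J hJ] := gJ u; have Ju := J_unit Uu hJ.
exists (mulmxr (invmx J)); split.
  by exists (N%:R * nR (invmx J)) => v; rewrite mulrC; exact: nR_mulmx.
move=> e e0; have c0 := c_gt0.
set b : R := N%:R * nR (invmx J) + 1.
have b0 : 0 < b by rewrite ltr_wpDl // mulr_ge0 ?nR_ge0.
(* The error of [psi] is the error of [g] carried back by [invmx J], of norm at most [b], and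
   [2 * c] is a Lipschitz constant of [psi]; dividing by both leaves [e]. *)
have [|t t0 ht] := hJ (e / (b * (2 * c))); first by rewrite divr_gt0 // !mulr_gt0.
have [r r0 hr] := W_ball Ww.
exists (Num.min r (t / (2 * c))); first by rewrite lt_min r0 divr_gt0 // mulr_gt0.
move=> y; rewrite lt_min ltr_pdivlMr ?mulr_gt0 // => /andP[/hr Wy hy].
have [] := psiP Wy; rewrite psiw; move: (psi y) => v Uv gv.
have [uv _] := Uu; have [vv _] := Uv.
have vu : nR (v - u) <= 2 * c * nR (y - w).
  apply: (le_trans (h_expand vv uv)); rewrite -mulrA; apply: ler_wpM2l => //.
  by apply: le_trans (h_le (g v) (g u)) _; rewrite gv gu.
have := ht v u; rewrite subrr nR0 => /(_ _ t0) h1.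
have {}h1 := h1 (le_lt_trans vu (eq_ind _ (fun z => z < t) hy _ (mulrC _ _))).
have -> : v - u - (y - w) *m invmx J = - ((g v - g u - (v - u) *m J) *m invmx J).
  by rewrite gv gu [in RHS]mulmxBl mulmxK // opprB.
rewrite nRN; apply: le_trans (nR_mulmx _ _) _.
apply: (@le_trans _ _ (e / (b * (2 * c)) * nR (v - u) * b)).
  by apply: ler_pM => //; rewrite ?nR_ge0 ?mulr_ge0 ?nR_ge0 // lerDl.
apply: (@le_trans _ _ (e / (b * (2 * c)) * (2 * c * nR (y - w)) * b)).
  apply: ler_wpM2r; first exact: ltW.
  by apply: ler_wpM2l => //; rewrite divr_ge0 ?mulr_ge0 // ltW.
by rewrite le_eqVlt; apply/orP; left; apply/eqP; field; rewrite !gt_eqF.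
Qed.

Local Lemma local_inverse :
  exists U W psi, [/\ U x, openK U, openK W, g @` U = W &
   [/\ forall u, U u -> psi (g u) = u,
       forall u, U u -> nR (u - x) < d,
       forall u, U u -> exists L, frechet g u L &
       forall w, W w -> exists L, frechet psi w L]].
Proof.
exists U, W, psi; split; [exact: Ux|exact: openU|exact: openW| |].
  apply/seteqP; split=> [_ [u [_ Wu] <-] //|w /h_surj [u Uu gu]].
  by exists u.
split=> [u|u [] //|u Uu|w]; [exact: psiK| |exact: psi_frechet].
by have [J' /g_frechet] := gJ u; exists (mulmxr J').
Qed.

End Local.

(** The radius [r] serves to keep [U] inside the ball on which a set is described by its
    equations. *)
Theorem inverse_function N (g : 'rV[K]_N -> 'rV[K]_N) x J (r : R) :
    (forall u, exists J, sderiv g u J) -> sderiv g x J -> J \in unitmx -> 0 < r ->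
  exists U W psi, [/\ U x, openK U, openK W, g @` U = W &
   [/\ forall u, U u -> psi (g u) = u,
       forall u, U u -> nR (u - x) < r,
       forall u, U u -> exists L, frechet g u L &
       forall w, W w -> exists L, frechet psi w L]].
Proof.
move=> gJ gx Ju r0.
have := sderiv_mulmx (invmx J) gx; rewrite mulmxV // => /(_ 2^-1 ltac:(lra)).
move=> [d d0 hd]; pose d' := Num.min d r.
have d'0 : 0 < d' by rewrite lt_min d0.
have {}hd u v : nR (u - x) < d' -> nR (v - x) < d' ->
  nR (g u *m invmx J - g v *m invmx J - (u - v)) <= 2^-1 * nR (u - v).
  rewrite !lt_min => /andP[hu _] /andP[hv _].
  by have := hd u v hu hv; rewrite mulmx1.
have [|U [W [psi [Ux oU oW gU [gK UB gD pD]]]]] := @local_inverse _ g x J gJ Ju d' d'0.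
  by move=> u v hu hv; exact: hd.
exists U, W, psi; split=> //; split=> // u /UB.
by rewrite lt_min => /andP[].
Qed.

End InverseFunction.

(** * Zero sets of maps with surjective derivative are smooth *)

Section RegularZero.
Variable R : realType.
Notation K := R[i].

Lemma frechet_comp_mxvec m n (W : normedModType K) (g : 'rV[K]_(m * n) -> W)
    (u : 'M[K]_(m, n)) L :
  frechet g (mxvec u) L ->
  exists L', frechet (fun v : 'M[K]_(m, n) => g (mxvec v)) u L'.
Proof.
move=> [[c hc] h]; exists (L \o mxvec : {linear _ -> _}); split.
  by exists c => v; apply: le_trans (hc _) _; rewrite nR_mxvec.
move=> e /h [d d0 hd]; exists d => // v hv.
by have := hd (mxvec v); rewrite -linearB nR_mxvec => /(_ hv).
Qed.

Lemma frechet_vec_mx m n (V : normedModType K) (g : V -> 'rV[K]_(m * n)) x L :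
  frechet g x L -> exists L', frechet (fun v => vec_mx (g v) : 'M[K]_(m, n)) x L'.
Proof.
move=> [[c hc] h]; exists (vec_mx \o L : {linear _ -> _}); split.
  by exists c => v; apply: le_trans (hc _); rewrite /= nR_vec_mx.
move=> e /h [d d0 hd]; exists d => // v /hd.
by rewrite /= -!linearB nR_vec_mx.
Qed.

(** The normal form [pid_mx q] puts the equations in the first [q] coordinates, while
    [coord_subspace] annihilates the last ones; reversing the order reconciles the two. *)
Definition rev_mx N : 'M[K]_N := \matrix_(i, j) (i == rev_ord j)%:R.

Lemma mul_rev_mxE m N (y : 'M[K]_(m, N)) i j : (y *m rev_mx N) i j = y i (rev_ord j).
Proof.
rewrite mxE (bigD1 (rev_ord j)) //= big1 ?addr0 => [|k hk].
  by rewrite mxE eqxx mulr1.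
by rewrite mxE (negbTE hk) mulr0.
Qed.

Lemma rev_mx_unit N : rev_mx N \in unitmx.
Proof.
suff /mulmx1_unit [] : rev_mx N *m rev_mx N = 1%:M by [].
by apply/matrixP => i j; rewrite mul_rev_mxE !mxE rev_ordK.
Qed.

Lemma coord_subspace_rev N q (y : 'rV[K]_N) : (q <= N)%N ->
  coord_subspace (N - q) (y *m rev_mx N) <-> y *m (pid_mx q : 'M[K]_(N, q)) = 0.
Proof.
move=> qN.
have yE (j : 'I_q) : (y *m (pid_mx q : 'M[K]_(N, q))) 0 j = y 0 (widen_ord qN j).
  rewrite mxE (bigD1 (widen_ord qN j)) //= big1 ?addr0.
    by rewrite !mxE eqxx /= ltn_ord mulr1.
  move=> k hk; rewrite !mxE; case: eqP => [e|]; last by rewrite mulr0.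
  by case/eqP: hk; apply: val_inj.
split=> [h|h i hi].
  apply/rowP => j; rewrite yE mxE.
  have := h (rev_ord (widen_ord qN j)); rewrite mul_rev_mxE rev_ordK; apply.
  by rewrite /= leq_sub2l // ltn_ord.
rewrite mul_rev_mxE.
have iq : (rev_ord i < q)%N.
  by rewrite /= ltn_subLR ?ltn_ord // addSn ltnS addnC -leq_subLR.
have := yE (Ordinal iq); rewrite h mxE => e.
by rewrite [RHS]e; congr (y 0 _); apply: val_inj.
Qed.

Theorem regular_zero m n q (S : set 'M[K]_(m, n)) (x : 'M[K]_(m, n))
    (F : 'rV[K]_(m * n) -> 'rV[K]_q) (J : 'M[K]_(m * n, q)) (r : R) :
  (forall u, exists J, sderiv F u J) -> sderiv F (mxvec x) J -> row_full J ->
  0 < r -> (forall u, nR (u - x) < r -> S u <-> F (mxvec u) = 0) -> S x ->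
  smooth_at S x (m * n - q).
Proof.
move=> FJ Fx Jf r0 hS Sx.
pose N := (m * n)%N.
have rJ : \rank J = q by apply/eqP.
have qN : (q <= N)%N by rewrite -rJ rank_leq_row.
pose Ce : 'M[K]_N := col_ebase J; pose Re : 'M[K]_q := row_ebase J.
have Ceu : Ce \in unitmx := col_ebase_unit J.
have Reu : Re \in unitmx := row_ebase_unit J.
have JE : J = Ce *m (pid_mx q : 'M[K]_(N, q)) *m Re by rewrite -{1}[J]mulmx_ebase rJ.
pose P : 'M[K]_(q, N) := pid_mx q; pose Q : 'M[K]_(N, q) := pid_mx q.
have PQ : P *m Q = 1%:M by rewrite /P /Q pid_mx_id // pid_mx_1.
have QP : Q *m P = pid_mx q by rewrite /P /Q pid_mx_id.
have CQ : copid_mx q *m Q = 0 by rewrite /copid_mx mulmxBl mul1mx pid_mx_id // subrr.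
(* The chart [g] uses the [q] equations as coordinates and completes them by linear ones, chosen
   from the normal form of [J] so that the derivative at [x] is the invertible [Ce *m rev_mx N]. *)
pose A := Ce *m copid_mx q *m rev_mx N.
pose B := invmx Re *m P *m rev_mx N.
pose g v := (v - mxvec x) *m A + F v *m B.
have gJ v : exists J, sderiv g v J.
  by have [J' h] := FJ v; eexists; apply: sderivD (sderiv_affine _ _ _) (sderiv_mulmx _ h).
have gx : sderiv g (mxvec x) (Ce *m rev_mx N).
  have := sderivD (sderiv_affine (mxvec x) (mxvec x) A) (sderiv_mulmx B Fx).
  rewrite (_ : A + J *m B = Ce *m rev_mx N) // /A /B !mulmxA.
  have -> : J *m invmx Re *m P = Ce *m pid_mx q by rewrite JE mulmxK // -mulmxA QP.
  by rewrite -mulmxDl -mulmxDr /copid_mx subrK mulmx1.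
have gu : Ce *m rev_mx N \in unitmx by rewrite unitmx_mul Ceu rev_mx_unit.
have [U [W [psi [Ux oU oW gU [gK UB gD pD]]]]] := inverse_function gJ gx gu r0.
have g0 v : coord_subspace (N - q) (g v) <-> F v = 0.
  have -> : g v = ((v - mxvec x) *m Ce *m copid_mx q + F v *m invmx Re *m P) *m rev_mx N.
    by rewrite mulmxDl /g /A /B !mulmxA.
  have -> := coord_subspace_rev _ qN.
  rewrite mulmxDl -!mulmxA PQ mulmx1 CQ !mulmx0 add0r.
  split=> [h|->]; last by rewrite mul0mx.
  by rewrite -[F v](mulmxKV Reu) h mul0mx.
split=> //; split; first exact: leq_subr.
exists [set u | U (mxvec u)], W, (fun u => g (mxvec u)), (fun w => vec_mx (psi w)).
have surjW w : W w -> exists2 u : 'M[K]_(m, n), U (mxvec u) & g (mxvec u) = w.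
  by rewrite -gU => -[v Uv <-]; exists (vec_mx v); rewrite vec_mxK.
have UB' (u : 'M[K]_(m, n)) : U (mxvec u) -> nR (u - x) < r.
  by move=> /UB; rewrite -linearB nR_mxvec.
split; [exact: Ux| |]; last first.
  apply/seteqP; split=> [_ [u [Su Uu] <-]|w [/surjW [u Uu <-] /g0 Fu]].
    split; first by rewrite -gU; exists (mxvec u).
    by apply/g0; apply/(hS u (UB' u Uu)).
  by exists u; [split; [apply/(hS u (UB' u Uu))|]|].
split.
- apply: open_nR => u Uu; have : nbhs (mxvec u : 'rV[K]_(m * n) : normedModType K) U.
    by apply: open_nbhs_nbhs; split.
  move=> /nbhs_nRP [d d0 hd]; exists d => // v hv; apply: hd.
  by rewrite -linearB nR_mxvec.
- exact: oW.
- split; last by move=> u Uu; rewrite gK // mxvecK.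
  apply/seteqP; split=> [_ [u Uu <-]|w /surjW [u]]; last by exists u.
  by rewrite -gU; exists (mxvec u).
- move=> u /gD [L /frechet_comp_mxvec [L' hL]]; exact: frechet_differentiable hL.
- move=> w /pD [L /(@frechet_vec_mx m n) [L' hL]]; exact: frechet_differentiable hL.
Qed.

End RegularZero.

(** * The dimension at a smooth point does not depend on the chart *)

Section Dimension.
Variable R : realType.
Notation K := R[i].

Lemma differentiable_row N q (f : ('rV[K]_N : normedModType K) -> ('rV[K]_q : normedModType K)) x :
  differentiable f x ->
  exists J : 'M[K]_(N, q), forall e : R, 0 < e -> exists2 d : R, 0 < d &
    forall u, nR (u - x) < d -> nR (f u - f x - (u - x) *m J) <= e * nR (u - x).
Proof.
move=> /diff_locallyP [_ /eqaddoP h].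
exists (lin1_mx ('d f x)) => e e0.
have /nbhs_nRP [d d0 hd] := h e%:C%C ltac:(by rewrite ltcR).
exists d => // u hu; have := hd (u - x); rewrite subr0 => /(_ hu).
rewrite /= !nRE -rmorphM lecR /= !fctE /= subrK mul_rV_lin1.
by rewrite opprD addrA.
Qed.

Lemma near_line N (w v : 'rV[K]_N) (d : R) : 0 < d ->
  exists2 t : R, 0 < t & nR (w + t%:C%C *: v - w) < d.
Proof.
move=> d0; have v0 := nR_ge0 v.
have v1 : 0 < nR v + 1 by lra.
exists (d / (2 * (nR v + 1))); first by rewrite divr_gt0 // mulr_gt0.
rewrite [w + _]addrC addrK nR_mxZ nR_real gtr0_norm ?divr_gt0 ?mulr_gt0 //.
rewrite mulrAC ltr_pdivrMr ?mulr_gt0 // ltr_pM2l //; lra.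
Qed.

Lemma coord_subspaceP N k (y : 'rV[K]_N) : coord_subspace k y <-> y *m copid_mx k = 0.
Proof.
rewrite /copid_mx mulmxBr mulmx1.
have yE i : (y *m (pid_mx k : 'M[K]_N)) 0 i = if (i < k)%N then y 0 i else 0.
  rewrite mxE (bigD1 i) //= big1 ?addr0 => [|j hj].
    by rewrite mxE eqxx /=; case: ifP; rewrite ?mulr1 ?mulr0.
  by rewrite mxE (inj_eq val_inj) (negbTE hj) mulr0.
split=> [h|h i hi].
  apply/rowP => i; rewrite addmxE oppmxE yE mxE.
  by case: ltnP => [_|/h ->]; rewrite ?subrr ?subr0.
have := congr1 (fun z : 'rV[K]_N => z 0 i) h.
by rewrite addmxE oppmxE yE mxE ltnNge hi /= subr0.
Qed.

(** Near [w0] the change of charts [f] has the left inverse [h], so its derivative [L] is injective.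
    It maps the first coordinate subspace into the second because [f] does so locally, and the ranks
    can be compared. *)
Lemma smooth_at_dim_le m n (S : set 'M[K]_(m, n)) x k1 k2 :
  smooth_at S x k1 -> smooth_at S x k2 -> (k1 <= k2)%N.
Proof.
move=> [Sx [k1N [U1 [W1 [p1 [q1 [Ux1 [oU1 oW1 [pU1 pK1] dp1 dq1] h1]]]]]]].
move=> [_ [k2N [U2 [W2 [p2 [q2 [Ux2 [oU2 oW2 [pU2 pK2] dp2 dq2] h2]]]]]]].
set N := (m * n)%N in k1N k2N W1 W2 p1 p2 q1 q2 oU1 oW1 pU1 pK1 dp1 dq1 h1
  oU2 oW2 pU2 pK2 dp2 dq2 h2 *.
pose w0 := p1 x; pose f w := p2 (q1 w); pose h w := p1 (q2 w).
have qw0 : q1 w0 = x by exact: pK1.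
have W1w : W1 w0 by rewrite -pU1; exists x.
have W2w : W2 (p2 x) by rewrite -pU2; exists x.
have q2x : q2 (p2 x) = x by exact: pK2.
have df : differentiable (f : ('rV[K]_N : normedModType K) -> ('rV[K]_N : normedModType K)) w0.
  apply: differentiable_comp; first exact: dq1.
  by rewrite qw0; exact: dp2.
have dh : differentiable (h : ('rV[K]_N : normedModType K) -> ('rV[K]_N : normedModType K)) (p2 x).
  apply: differentiable_comp; first exact: dq2.
  by rewrite q2x; exact: dp1.
have [L hL] := differentiable_row df; have [L' hL'] := differentiable_row dh.
have fw0 : f w0 = p2 x by rewrite /f qw0.
have [d d0 hd] : exists2 d : R, 0 < d & forall w, nR (w - w0) < d ->
    W1 w /\ U2 (q1 w).
  have n1 : nbhs (w0 : 'rV[K]_N : normedModType K) W1 by apply: open_nbhs_nbhs; split.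
  have n2 : nbhs (w0 : 'rV[K]_N : normedModType K) (q1 @^-1` U2).
    apply: (differentiable_continuous (dq1 _ W1w)); rewrite qw0.
    by apply: open_nbhs_nbhs; split.
  have : nbhs (w0 : 'rV[K]_N : normedModType K) (W1 `&` q1 @^-1` U2) by apply: filterI.
  by move=> /nbhs_nRP [d d0 hd]; exists d => // w /hd.
have U1q w : W1 w -> U1 (q1 w) /\ p1 (q1 w) = w.
  by rewrite -pU1 => -[u Uu <-]; rewrite pK1.
have hf w : nR (w - w0) < d -> h (f w) = w.
  by move=> /hd [/U1q [_ e] ?]; rewrite /h /f pK2.
(* If [L] kills [v], a small step along [v] moves [f] by at most [1 / (2 * c)] of its length. Since
   [h] expands distances from [p2 x] at most by [c], it returns a step of at most half the original
   length, which is therefore 0. *)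
have Linj (v : 'rV[K]_N) : v *m L = 0 -> v = 0.
  move=> vL.
  set c : R := 1 + N%:R * nR L'.
  have c0 : 0 < c by rewrite ltr_pwDl // mulr_ge0 ?nR_ge0.
  have [d1 d10 hd1] := hL (1 / (2 * c)) (divr_gt0 ltr01 (mulr_gt0 (ltr0n _ 2) c0)).
  have [d2 d20 hd2] := hL' 1 ltr01.
  have [|t t0 ht] := @near_line _ w0 v (Num.min d (Num.min d1 (d2 * c))).
    by rewrite !lt_min d0 d10 mulr_gt0.
  move: ht; set w := w0 + _; rewrite !lt_min => /andP[wd /andP[wd1 wd2]].
  have wE : w - w0 = t%:C%C *: v by rewrite /w [w0 + _]addrC addrK.
  have := hd1 w wd1; rewrite [in (w - w0) *m L]wE -scalemxAl vL scaler0 subr0 => b1.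
  have b1' : c * nR (f w - f w0) <= nR (w - w0) / 2.
    have := ler_wpM2l (ltW c0) b1.
    by rewrite (_ : c * (1 / (2 * c) * _) = nR (w - w0) / 2) //; field; rewrite gt_eqF.
  have fd2 : nR (f w - p2 x) < d2.
    rewrite -(ltr_pM2l c0) -fw0 [c * d2]mulrC; have := nR_ge0 (w - w0); lra.
  have := hd2 _ fd2; rewrite -fw0 !hf ?subrr ?nR0 // mul1r => b2.
  have b3 := nR_mulmx (f w - f w0) L'.
  have b4 : nR (w - w0) <= nR (w - w0) / 2.
    apply: le_trans b1'.
    rewrite -[X in nR X <= _](subrK ((f w - f w0) *m L')).
    by apply: le_trans (nRD _ _) _; rewrite /c mulrDl mul1r [N%:R * _ * _]mulrC lerD.
  have : nR (w - w0) = 0 by have := nR_ge0 (w - w0); lra.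
  rewrite wE => /nR_eq0/eqP; rewrite scaler_eq0 => /orP[/eqP [] e|/eqP //].
  by move: t0; rewrite e ltxx.
have Lu : L \in unitmx.
  rewrite -row_free_unit -kermx_eq0; apply/eqP/row_matrixP => i.
  by rewrite row0; apply: Linj; rewrite -row_mul mulmx_ker row0.
(* A coordinate of [f] that vanishes along the segment from [w0] in direction [v] has derivative 0
   in that direction; a nonzero value would exceed the tolerance, set to half of it per unit of
   [nR v]. *)
have Lsub (v : 'rV[K]_N) : coord_subspace k1 v -> coord_subspace k2 (v *m L).
  move=> hv i hi; apply/eqP; rewrite -[_ == 0]negbK; apply/negP => /eqP vi0.
  have vi : 0 < nR ((v *m L) 0 i).
    by rewrite lt_neqAle nR_ge0 andbT eq_sym; apply/eqP => /nR_eq0.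
  have v0 : 0 < nR v.
    rewrite lt_neqAle nR_ge0 andbT eq_sym; apply/eqP => /nR_eq0 e.
    by apply: vi0; rewrite e mul0mx mxE.
  have [|d1 d10 hd1] := hL (nR ((v *m L) 0 i) / (2 * nR v)).
    by rewrite divr_gt0 // mulr_gt0.
  have [|t t0 ht] := @near_line _ w0 v (Num.min d d1); first by rewrite lt_min d0.
  move: ht; set w := w0 + _; rewrite lt_min => /andP[wd wd1].
  have wE : w - w0 = t%:C%C *: v by rewrite /w [w0 + _]addrC addrK.
  have fcoord w' : nR (w' - w0) < d -> coord_subspace k1 w' -> coord_subspace k2 (f w').
    move=> /hd [Ww' Uq] cw'.
    have : (p1 @` (S `&` U1)) w' by rewrite h1; split.
    move=> [u [Su Uu] e]; have : (p2 @` (S `&` U2)) (f w').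
      by exists (q1 w') => //; split=> //; rewrite -e pK1.
    by rewrite h2 => -[].
  have cw0 : coord_subspace k1 w0.
    have : (p1 @` (S `&` U1)) w0 by exists x.
    by rewrite h1 => -[].
  have fw : f w 0 i = 0.
    apply: (fcoord w wd) => // j hj; rewrite /w !mxE cw0 // hv // mulr0 addr0 //.
  have fw00 : f w0 0 i = 0 by apply: (fcoord w0) => //; rewrite subrr nR0.
  have := le_trans (nR_entry _ 0 i) (hd1 w wd1).
  rewrite wE -scalemxAl nR_mxZ nR_real gtr0_norm //.
  rewrite !mxE fw fw00 subrr sub0r nRN nRM nR_real gtr0_norm //.
  have -> : nR (\sum_j v 0 j * L j i) = nR ((v *m L) 0 i) by rewrite mxE.
  rewrite leNgt => /negP; apply.
  have -> : nR ((v *m L) 0 i) / (2 * nR v) * (t * nR v) = t * nR ((v *m L) 0 i) / 2.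
    by field; rewrite gt_eqF.
  have := mulr_gt0 t0 vi; lra.
have : (pid_mx k1 : 'M[K]_N) *m L *m copid_mx k2 = 0.
  apply/row_matrixP => i; rewrite !row_mul row0; apply/coord_subspaceP/Lsub.
  apply/coord_subspaceP; rewrite -row_mul mul_pid_mx_copid // row0 //.
rewrite /copid_mx mulmxBr mulmx1 => /subr0_eq e.
rewrite -(@rank_pid_mx K N N k1) // -(mxrankMfree _ (_ : row_free L)) ?row_free_unit //.
by rewrite e; apply: leq_trans (mxrankM_maxr _ _) _; rewrite rank_pid_mx.
Qed.

Theorem smooth_at_dim m n (S : set 'M[K]_(m, n)) x k1 k2 :
  smooth_at S x k1 -> smooth_at S x k2 -> k1 = k2.
Proof. by move=> h1 h2; apply/eqP; rewrite eqn_leq !(@smooth_at_dim_le _ _ S x). Qed.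

Lemma cdim_eq m n (S : set 'M[K]_(m, n)) x k :
  S x -> (forall y, S y -> smooth_at S y k) -> cdim S = k.
Proof.
move=> Sx h; have kN : (k < (m * n).+1)%N by have [_ []] := h x Sx.
apply/eqP; rewrite eqn_leq; apply/andP; split.
  apply/bigmax_leqP => j /asboolP [y hy].
  by rewrite (smooth_at_dim hy (h y _)) //; case: hy.
apply: (@leq_bigmax_cond _ _ (fun i : 'I_(m * n).+1 => i : nat) (Ordinal kN)).
by apply/asboolP; exists x; exact: h.
Qed.

End Dimension.

(** * Local equations and dimension of a conjugacy class *)

Section ConjugacyClass.
Variable R : realType.
Notation K := R[i].

Lemma smooth1_neq0 N (f : 'rV[K]_N -> K) x : smooth1 f -> f x != 0 ->
  exists2 d : R, 0 < d & forall u, nR (u - x) < d -> f u != 0.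
Proof.
move=> /(_ x) [J hJ] fx.
have f0 : 0 < nR (f x).
  by rewrite lt_neqAle nR_ge0 andbT eq_sym; apply: contra_neq fx => /nR_eq0.
have [|d d0 hd] := @sderiv1_continuous _ _ _ _ _ (nR (f x) / 2) hJ; first by rewrite divr_gt0.
exists d => // u hu; apply/eqP => e.
have := hd u u hu hu; rewrite e sub0r nRN; lra.
Qed.

Lemma eq_rowmul N q (A B : 'M[K]_(N, q)) : (forall h : 'rV_N, h *m A = h *m B) -> A = B.
Proof. by move=> h; apply/row_matrixP => i; rewrite !rowE. Qed.

Lemma eq_mxvecmul m n q (A B : 'M[K]_(m * n, q)) :
  (forall X : 'M[K]_(m, n), mxvec X *m A = mxvec X *m B) -> A = B.
Proof. by move=> h; apply: eq_rowmul => v; rewrite -[v]vec_mxK h. Qed.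

Lemma mulmx_col_base m n p (x : 'M[K]_(m, n)) (B : 'M[K]_(n, p)) :
  x *m col_base B = 0 <-> x *m B = 0.
Proof.
split=> h; first by rewrite -[B]mulmx_base mulmxA h mul0mx.
by apply: (row_free_inj (row_base_free B)); rewrite mul0mx -mulmxA mulmx_base.
Qed.

Lemma rank_unit_mul (F : fieldType) m n (U : 'M[F]_m) (A : 'M[F]_(m, n)) (V : 'M[F]_n) :
  U \in unitmx -> V \in unitmx -> \rank (U *m A *m V) = \rank A.
Proof.
move=> Uu Vu; rewrite mxrankMfree ?row_free_unit //.
by rewrite (eqmxMfull A (_ : row_full U)) ?row_full_unit.
Qed.

Lemma mulmxA4 (F : fieldType) m n p q r (A : 'M[F]_(m, n)) (B : 'M[F]_(n, p))
    (C : 'M[F]_(p, q)) (D : 'M[F]_(q, r)) : A *m (B *m C *m D) = A *m B *m C *m D.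
Proof. by rewrite !mulmxA. Qed.

(** The kernel of [M] lies in that of [M *m B], and equal ranks give them the same dimension. *)
Lemma sub_ker_rank (F : fieldType) m n p (M : 'M[F]_(m, n)) (B : 'M[F]_(n, p)) q
    (x : 'M[F]_(q, m)) :
  \rank (M *m B) = \rank M -> x *m (M *m B) = 0 -> x *m M = 0.
Proof.
move=> e x0.
have : (kermx M <= kermx (M *m B))%MS.
  by apply/sub_kermxP; rewrite mulmxA mulmx_ker mul0mx.
move=> /mxrank_leqif_sup [_]; rewrite !mxrank_ker e eqxx => /esym hk.
by apply/sub_kermxP; apply: submx_trans hk; apply/sub_kermxP.
Qed.

Lemma conj_conjV (F : fieldType) n (g h A : 'M[F]_n) : g \in unitmx ->
  h *m A *m invmx h = h *m invmx g *m (g *m A *m invmx g) *m (g *m invmx h).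
Proof. by move=> gu; rewrite !mulmxA !mulmxKV. Qed.

(** Computes the derivative in [class_equation]: there [e] is the row of the identity matrix and [l]
    is left multiplication by the increment, so [e *m l] is the increment itself. *)
Lemma deriv_at_one (F : fieldType) N q (e h : 'rV[F]_N) (C l B : 'M[F]_N)
    (b : 'M[F]_(N, q)) : C \in unitmx -> e *m l = h ->
  e *m C *m (invmx C *m (- 1%:M *m l) *m B) *m b = h *m - (B *m b).
Proof.
move=> Cu <-; rewrite mulNmx mul1mx mulmxN !mulNmx !mulmxN mulNmx.
by rewrite !mulmxA mulmxK.
Qed.

Section Intertwiner.
Variable n : nat.
Implicit Types A B g X : 'M[K]_n.

(** An invertible [X] in the kernel conjugates [A] into [B]. For [B = A] the kernel is the
    centralizer and the image is the tangent space of the class at [A]. *)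
Definition intertwiner A B : 'M[K]_(n * n) := lin_mulmxr A - lin_mulmx B.

Lemma mul_intertwiner A B X :
  mxvec X *m intertwiner A B = mxvec (X *m A - B *m X).
Proof. by rewrite /intertwiner mulmxBr !mul_vec_lin /= linearB. Qed.

Lemma rank_intertwiner_lel A B g : g \in unitmx ->
  (\rank (intertwiner (g *m A *m invmx g) B) <= \rank (intertwiner A B))%N.
Proof.
move=> gu.
have -> : intertwiner (g *m A *m invmx g) B =
    lin_mulmxr g *m intertwiner A B *m lin_mulmxr (invmx g).
  apply: eq_mxvecmul => X; rewrite !mulmxA mul_vec_lin !mul_intertwiner mul_vec_lin /=.
  by rewrite mulmxBl !mulmxA mulmxK.
exact: leq_trans (mxrankM_maxl _ _) (mxrankM_maxr _ _).
Qed.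

Lemma rank_intertwiner_ler A B g : g \in unitmx ->
  (\rank (intertwiner A (g *m B *m invmx g)) <= \rank (intertwiner A B))%N.
Proof.
move=> gu.
have -> : intertwiner A (g *m B *m invmx g) =
    lin_mulmx (invmx g) *m intertwiner A B *m lin_mulmx g.
  apply: eq_mxvecmul => X; rewrite !mulmxA mul_vec_lin !mul_intertwiner mul_vec_lin /=.
  by rewrite mulmxBr !mulmxA mulmxV // mul1mx.
exact: leq_trans (mxrankM_maxl _ _) (mxrankM_maxr _ _).
Qed.

Lemma conjK A g : g \in unitmx -> invmx g *m (g *m A *m invmx g) *m invmx (invmx g) = A.
Proof. by move=> gu; rewrite invmxK !mulmxA mulVmx // mul1mx mulmxKV. Qed.

Lemma rank_intertwinerl A B g : g \in unitmx ->
  \rank (intertwiner (g *m A *m invmx g) B) = \rank (intertwiner A B).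
Proof.
move=> gu; apply/eqP; rewrite eqn_leq; apply/andP; split; first exact (rank_intertwiner_lel A B gu).
have gV : invmx g \in unitmx by rewrite unitmx_inv.
by have := rank_intertwiner_lel (g *m A *m invmx g) B gV; rewrite (conjK A gu).
Qed.

Lemma rank_intertwinerr A B g : g \in unitmx ->
  \rank (intertwiner A (g *m B *m invmx g)) = \rank (intertwiner A B).
Proof.
move=> gu; apply/eqP; rewrite eqn_leq; apply/andP; split; first exact (rank_intertwiner_ler A B gu).
have gV : invmx g \in unitmx by rewrite unitmx_inv.
by have := rank_intertwiner_ler A (g *m B *m invmx g) gV; rewrite (conjK B gu).
Qed.

Lemma conjugacy_class_refl A : conjugacy_class A A.
Proof. by exists 1%:M; rewrite ?unitmx1 // invmx1 mulmx1 mul1mx. Qed.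

Lemma conjugacy_class_eq A B : conjugacy_class A B -> conjugacy_class A = conjugacy_class B.
Proof.
move=> [g gu ->]; apply/seteqP; split=> _ [h hu ->].
  exists (h *m invmx g); first by rewrite unitmx_mul hu unitmx_inv.
  have -> : invmx (h *m invmx g) = g *m invmx h.
    apply: (row_free_inj (_ : row_free (h *m invmx g))).
      by rewrite row_free_unit unitmx_mul hu unitmx_inv.
    by rewrite mulVmx ?unitmx_mul ?hu ?unitmx_inv // mulmxA mulmxKV // mulmxV.
  exact: conj_conjV.
exists (h *m g); first by rewrite unitmx_mul hu.
have -> : invmx (h *m g) = invmx g *m invmx h.
  apply: (row_free_inj (_ : row_free (h *m g))).
    by rewrite row_free_unit unitmx_mul hu.
  by rewrite mulVmx ?unitmx_mul ?hu // mulmxA mulmxKV // mulVmx.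
by rewrite !mulmxA.
Qed.

(* With [L_B] the matrix of [X |-> X A - B X], put in the normal form of [L_A],
   Cramer's rule yields a solution [X(B)], polynomial in [B] and with [X(A) = 1],
   of [\rank L_A] of the equations [X L_B = 0]. The remaining ones vanish near [A]
   exactly when [\rank L_B = \rank L_A], i.e. on the class. *)
Theorem class_equation A :
  exists (q : nat) (F : 'rV[K]_(n * n) -> 'rV[K]_q) (J : 'M[K]_(n * n, q)),
  [/\ q = (n * n - \rank (intertwiner A A))%N,
      (forall u, exists J', sderiv F u J') /\ sderiv F (mxvec A) J,
      row_full J,
      forall X, mxvec (X *m A - A *m X) *m J = 0 &
      exists2 d : R, 0 < d & forall B, nR (B - A) < d ->
        conjugacy_class A B <-> F (mxvec B) = 0].
Proof.
pose N := (n * n)%N; pose L0 := intertwiner A A; pose r := \rank L0.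
have rN : (r <= N)%N by exact: rank_leq_row.
pose Ce : 'M[K]_N := col_ebase L0; pose Re : 'M[K]_N := row_ebase L0.
have Ceu : Ce \in unitmx := col_ebase_unit L0.
have Reu : Re \in unitmx := row_ebase_unit L0.
pose I : 'M[K]_N := pid_mx r; pose I' : 'M[K]_N := copid_mx r.
have L0E : L0 = Ce *m I *m Re by rewrite -{1}[L0]mulmx_ebase.
have II : I *m I = I by rewrite /I pid_mx_id.
have I'I : I' *m I = 0 by rewrite /I' /copid_mx mulmxBl mul1mx II subrr.
have II' : I *m I' = 0 by rewrite /I' /copid_mx mulmxBr mulmx1 II subrr.
have I1 : I + I' = 1%:M by rewrite /I' /copid_mx addrC subrK.
pose T (v : 'rV[K]_N) := intertwiner A (vec_mx v).
pose M v := invmx Ce *m T v *m invmx Re.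
(* The first [r] columns of [M v], completed by those of the identity to a matrix that is invertible
   near [A]. *)
pose P v := M v *m I + I'.
pose z := mxvec (1%:M : 'M[K]_n) *m Ce.
(* Since [y v *m P v] is a multiple of [z], and [z *m I = 0] because the identity commutes with [A],
   the first [r] equations hold identically ([GI]). *)
pose y v := z *m \adj (P v).
pose G v := y v *m M v.
(* Keeps only the last [N - r] equations, without the zero columns of [I']. *)
pose b : 'M[K]_(N, \rank I') := col_base I'.
have Ib : I *m b = 0 by apply/mulmx_col_base.
pose a := mxvec A.
have Ma : M a = I.
  by rewrite /M /T mxvecK -/L0 L0E !mulmxA mulVmx // mul1mx mulmxK.
have Pa : P a = 1%:M by rewrite /P Ma II I1.
have zI : z *m I = 0.
  apply: (row_free_inj (_ : row_free Re)); first by rewrite row_free_unit.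
  by rewrite mul0mx /z -!mulmxA [Ce *m _]mulmxA -L0E mul_intertwiner mul1mx mulmx1 subrr linear0.
have hT x : mderiv T x (fun h => (- 1%:M) *m lin_mulmx (vec_mx h)).
  pose l : {linear 'rV[K]_N -> 'M[K]_N} := (lin_mulmx \o vec_mx : {linear _ -> _}).
  have := mderivD (mderiv_cst (lin_mulmxr A : 'M[K]_N) x) (mderiv_mull (- 1%:M) (mderiv_linear l x)).
  apply: mderiv_eq => h; last by rewrite add0r.
  by rewrite mulNmx mul1mx.
have hM x := mderiv_mulr (invmx Re) (mderiv_mull (invmx Ce) (hT x)).
have sP : smooth_mx P.
  by move=> x; eexists; exact: mderivD (mderiv_mulr I (hM x)) (mderiv_cst I' x).
have sy : smooth_mx y.
  move=> x; have [D h] := smooth_adj sP x; exists (fun u => z *m D u).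
  exact (mderiv_mull z h).
have hG x : exists D, mderiv G x D.
  by have [D h] := sy x; eexists; exact: mderiv_mulmx h (hM x).
pose F v := G v *m b.
have hF x : exists D, mderiv F x D.
  have [D h] := hG x; exists (fun u => D u *m b).
  exact (mderiv_mulr b h).
pose J := - (invmx Re *m b).
have FJ : sderiv F a J.
  have [D hD] := sy a.
  have [J' hJ' eJ'] := mderiv_sderiv (mderiv_mulr b (mderiv_mulmx hD (hM a))).
  suff -> : J = J' by [].
  apply: eq_rowmul => h; rewrite -eJ'; cbv beta.
  (* The derivative of [y] is multiplied by [M a = I], which [b] kills; so only the derivative of
     [M] contributes and that of the adjugate need not be known. *)
  rewrite mulmxDl -/(M a) Ma -mulmxA Ib mulmx0 add0r.
  rewrite /y Pa adj1 mulmx1; apply/esym/deriv_at_one => //.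
  by rewrite mul_vec_lin /= mulmx1 vec_mxK.
have GI v : G v *m I = 0.
  have PI : P v *m I = M v *m I by rewrite /P mulmxDl I'I addr0 -mulmxA II.
  by rewrite /G -mulmxA -PI /y -mulmxA [\adj _ *m _]mulmxA mul_adj_mx mul_scalar_mx
    -scalemxAr zI scaler0.
have GF v : F v = 0 <-> G v = 0.
  rewrite /F mulmx_col_base; split=> [h|->]; last by rewrite mul0mx.
  by rewrite -[G v]mulmx1 -I1 mulmxDr GI h addr0.
exists (\rank I'), F, J; split.
- by rewrite rank_copid_mx.
- split=> // u; have [D /mderiv_sderiv [J' h _]] := hF u; by exists J'.
- rewrite /row_full /J mxrank_opp; apply/eqP.
  rewrite (eqmxMfull b (_ : row_full (invmx Re))) ?row_full_unit ?unitmx_inv //.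
  by apply/eqP; exact: col_base_full.
- move=> X; rewrite -mul_intertwiner -/L0 L0E /J mulmxN !mulmxA mulmxK //.
  by rewrite -!mulmxA Ib !mulmx0 oppr0.
have [d1 d10 hd1] : exists2 d : R, 0 < d & forall u, nR (u - a) < d -> \det (P u) != 0.
  by apply: smooth1_neq0; [exact: smooth_det | rewrite Pa det1 oner_eq0].
pose X v : 'M[K]_n := vec_mx (y v *m invmx Ce).
have [d2 d20 hd2] : exists2 d : R, 0 < d & forall u, nR (u - a) < d -> \det (X u) != 0.
  apply: smooth1_neq0; last first.
    by rewrite /X /y Pa adj1 mulmx1 /z mulmxK // mxvecK det1 oner_eq0.
  apply/smooth_det/smooth_mxP => i j.
  have [s hs] : exists s : 'I_N, forall v, X v i j = (y v *m invmx Ce) 0 s.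
    by exists (mxvec_index i j) => v; rewrite -[X v i j]mxvecE /X vec_mxK.
  apply: (@smooth1_eq _ _ (fun v => (y v *m invmx Ce) 0 s)) => //.
  apply: (proj1 (smooth_mxP _)) => x.
  have [D h] := sy x; exists (fun u => D u *m invmx Ce).
  exact (mderiv_mulr (invmx Ce) h).
exists (Num.min d1 d2); first by rewrite lt_min d10.
move=> B; rewrite lt_min -nR_mxvec linearB => /andP[/hd1 Pu /hd2 Xu].
rewrite GF; set v := mxvec B in Pu Xu *.
have TB : T v = intertwiner A B by rewrite /T mxvecK.
(* On the class [M v] keeps rank [r], which its first [r] columns already have, so they determine
   its kernel and the [r] solved equations imply the others. Conversely, a zero of [G] makes [X v]
   an invertible intertwiner. *)
split=> [[g gu eB]|G0].
  have PI : P v *m I = M v *m I by rewrite /P mulmxDl I'I addr0 -mulmxA II.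
  have Pvu : P v \in unitmx by rewrite unitmxE unitfE.
  have rM : \rank (M v) = r.
    have CV : invmx Ce \in unitmx by rewrite unitmx_inv.
    have RV : invmx Re \in unitmx by rewrite unitmx_inv.
    apply: (etrans (rank_unit_mul (T v) CV RV)).
    by rewrite TB eB; exact (rank_intertwinerr A A gu).
  have rMI : \rank (M v *m I) = r.
    have h1 := @rank_unit_mul _ _ _ (P v) I 1%:M Pvu (unitmx1 _ _).
    by rewrite -PI -[P v *m I]mulmx1 h1 rank_pid_mx.
  have h1 := @sub_ker_rank _ _ _ _ (M v) I _ (y v).
  apply: h1; first by rewrite rM rMI.
  by rewrite mulmxA; exact (GI v).
exists (X v); first by rewrite unitmxE unitfE.
have : mxvec (X v) *m intertwiner A B = 0.
  rewrite /X vec_mxK -TB; apply: (row_free_inj (_ : row_free (invmx Re))).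
    by rewrite row_free_unit unitmx_inv.
  by rewrite mul0mx -mulmxA4; exact G0.
rewrite mul_intertwiner => /(congr1 vec_mx); rewrite mxvecK linear0 => /subr0_eq ->.
by rewrite mulmxK // unitmxE unitfE.
Qed.

Theorem smooth_at_class A : smooth_at (conjugacy_class A) A (\rank (intertwiner A A)).
Proof.
have [q [F [J [eq [FJ FA] Jf _ [d d0 hd]]]]] := class_equation A.
have -> : \rank (intertwiner A A) = (n * n - q)%N by rewrite eq subKn // rank_leq_row.
exact: regular_zero FJ FA Jf d0 hd (conjugacy_class_refl A).
Qed.

(** Conjugating both arguments of [intertwiner] preserves its rank, so all points of the class are
    smooth of one dimension and the maximum in [cdim] is that value. *)
Theorem cdim_class A : cdim (conjugacy_class A) = \rank (intertwiner A A).
Proof.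
apply: (cdim_eq (conjugacy_class_refl A)) => B hB.
have e : \rank (intertwiner B B) = \rank (intertwiner A A).
  case: hB => g gu ->.
  exact (etrans (rank_intertwinerl A _ gu) (rank_intertwinerr A A gu)).
by have := smooth_at_class B; rewrite e -(conjugacy_class_eq hB).
Qed.

End Intertwiner.

End ConjugacyClass.

(** * Derivatives of concatenated maps, surjectivity by duality, the trace form *)

Section Jacobian.
Variable R : realType.
Notation K := R[i].

Lemma sderiv_row_mx N q r (F : 'rV[K]_N -> 'rV[K]_q) (G : 'rV[K]_N -> 'rV[K]_r) x J J' :
  sderiv F x J -> sderiv G x J' ->
  sderiv (fun u => row_mx (F u) (G u)) x (row_mx J J').
Proof.
move=> hF hG e e0; apply: near2_imp (near2_and (hF e e0) (hG e e0)) => u v [h1 h2].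
have e1 : 0 <= e * nR (u - v) by rewrite mulr_ge0 ?nR_ge0 // ltW.
rewrite mul_mx_row !opp_row_mx !add_row_mx; apply: nR_mxle => // i j; rewrite ord1.
by case: (split_ordP j) => k ->; rewrite ?row_mxEl ?row_mxEr; apply: le_trans (nR_entry _ _ _) _.
Qed.

Lemma sderiv_mxrow N p (q : 'I_p -> nat) (F : forall j, 'rV[K]_N -> 'rV[K]_(q j)) x
    (J : forall j, 'M[K]_(N, q j)) :
  (forall j, sderiv (F j) x (J j)) ->
  sderiv (fun u => \mxrow_j F j u) x (\mxrow_j J j).
Proof.
move=> h e e0; apply: near2_imp (near2_forall (fun j => h j e e0)) => u v hj.
have e1 : 0 <= e * nR (u - v) by rewrite mulr_ge0 ?nR_ge0 // ltW.
apply: nR_mxle => // i k; rewrite ord1.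
rewrite mul_mxrow !mxE.
apply: le_trans (hj (tagnat.sig1 k)).
by apply: le_trans (nR_entry _ 0 (tagnat.sig2 k)); rewrite !mxE.
Qed.

Lemma sderiv_comp_mulmx N m q (F : 'rV[K]_m -> 'rV[K]_q) (A : 'M[K]_(N, m)) x J :
  sderiv F (x *m A) J -> sderiv (fun u => F (u *m A)) x (A *m J).
Proof.
move=> h e e0; set c : R := N%:R * nR A + 1.
have c0 : 0 < c by rewrite ltr_wpDl // mulr_ge0 ?nR_ge0.
have hA (u v : 'rV[K]_N) : nR (u *m A - v *m A) <= c * nR (u - v).
  rewrite -mulmxBl; apply: le_trans (nR_mulmx _ _) _; rewrite mulrC.
  by apply: ler_wpM2r; rewrite ?nR_ge0 // lerDl.
have [d d0 hd] := h (e / c) (divr_gt0 e0 c0).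
exists (d / c) => [|u v]; first exact: divr_gt0.
rewrite !ltr_pdivlMr // ![_ * c]mulrC => hu hv.
have := hd (u *m A) (v *m A) (le_lt_trans (hA _ _) hu) (le_lt_trans (hA _ _) hv).
rewrite -mulmxBl -mulmxA mulmxBl => /le_trans; apply.
apply: (@le_trans _ _ (e / c * (c * nR (u - v)))).
  by apply: ler_wpM2l; [rewrite divr_ge0 // ltW | exact: hA].
by rewrite mulrA divfK // gt_eqF.
Qed.

Lemma row_full_inj N q (J : 'M[K]_(N, q)) :
  (forall w : 'cV[K]_q, J *m w = 0 -> w = 0) -> row_full J.
Proof.
move=> h; rewrite /row_full -mxrank_tr -/(row_free J^T) -kermx_eq0.
apply/eqP/row_matrixP => i; rewrite row0; apply: trmx_inj; rewrite trmx0; apply: h.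
by apply: trmx_inj; rewrite trmx_mul trmxK trmx0 -row_mul mulmx_ker row0.
Qed.

Lemma row_full_mul0 N q r (J : 'M[K]_(N, q)) (w : 'M[K]_(q, r)) :
  row_full J -> J *m w = 0 -> w = 0.
Proof. by move=> /row_fullP [B BJ] h; rewrite -[w]mul1mx -BJ -mulmxA h mulmx0. Qed.

(** Turns a linear relation between derivatives into a matrix [Y], on which commutation can be
    tested. *)
Lemma trace_form n (c : 'cV[K]_(n * n)) :
  exists Y : 'M[K]_n, forall Z : 'M[K]_n, (mxvec Z *m c) 0 0 = \tr (Y *m Z).
Proof.
exists (\matrix_(j, i) (mxvec (delta_mx i j : 'M[K]_n) *m c) 0 0) => Z.
rewrite {1}[Z]matrix_sum_delta /mxtrace.
under [RHS]eq_bigr do rewrite mxE.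
rewrite exchange_big /= linear_sum mulmx_suml summxE; apply: eq_bigr => i _.
rewrite linear_sum mulmx_suml summxE; apply: eq_bigr => j _.
by rewrite linearZ -scalemxAl !mxE mulrC.
Qed.

Lemma trace_form_inj n (Q : 'M[K]_n) : (forall X : 'M[K]_n, \tr (Q *m X) = 0) -> Q = 0.
Proof.
move=> h; apply/matrixP => i j; have := h (delta_mx j i).
rewrite /mxtrace (bigD1 i) //= big1 => [|k hk].
  rewrite addr0 mxE (bigD1 j) //= big1 => [|k hk].
    by rewrite !mxE !eqxx mulr1 addr0.
  by rewrite !mxE (negbTE hk) mulr0.
rewrite mxE big1 // => l _; rewrite !mxE (negbTE hk) andbF mulr0 //.
Qed.

End Jacobian.

(** * The derivative of the product of the matrices and its annihilator *)

Section Product.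
Variables (R : realType) (n p : nat).
Notation K := R[i].
Implicit Types (s : seq 'I_p) (v h : 'rV[K]_(p * (n * n))) (M : 'I_p -> 'M[K]_n).

Definition mxprod s M : 'M[K]_n := \big[mulmx/1%:M]_(j <- s) M j.

Lemma mxprod_cat s s' M : mxprod (s ++ s') M = mxprod s M *m mxprod s' M.
Proof.
rewrite /mxprod; elim: s => [|j s ih]; first by rewrite big_nil mul1mx.
by rewrite cat_cons !big_cons ih mulmxA.
Qed.

Lemma mxprod1 j M : mxprod [:: j] M = M j.
Proof. by rewrite /mxprod big_cons big_nil mulmx1. Qed.

Lemma det_mxprod s M : \det (mxprod s M) = \prod_(j <- s) \det (M j).
Proof.
rewrite /mxprod; elim: s => [|j s ih]; first by rewrite !big_nil det1.
by rewrite !big_cons det_mulmx ih.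
Qed.

Definition component v (j : 'I_p) : 'M[K]_n := vec_mx (row j (vec_mx v)).

Lemma mderiv_component x j : mderiv (fun v => component v j) x (fun h => component h j).
Proof.
pose l : {linear 'rV[K]_(p * (n * n)) -> 'M[K]_n} := (vec_mx \o (row j \o vec_mx) : {linear _ -> _}).
exact (mderiv_linear l x).
Qed.

Fixpoint dprod s v h : 'M[K]_n :=
  if s is j :: s' then
    component h j *m mxprod s' (component v) + component v j *m dprod s' v h
  else 0.

Lemma mderiv_mxprod s x : mderiv (fun v => mxprod s (component v)) x (dprod s x).
Proof.
elim: s => [|j s ih].
  by apply: mderiv_eq (mderiv_cst 1%:M x) => // v; rewrite /mxprod big_nil.
apply: mderiv_eq (mderiv_mulmx (mderiv_component x j) ih) => // v.
by rewrite /mxprod big_cons.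
Qed.

(** Linear relations are tested by moving one matrix at a time, which leaves one term of the Leibniz
    sum; [uniq] ensures that the moved factor occurs only once. *)
Lemma dprod_single s s' x h j :
  (forall i, i != j -> component h i = 0) -> uniq (s ++ j :: s') ->
  dprod (s ++ j :: s') x h =
  mxprod s (component x) *m component h j *m mxprod s' (component x).
Proof.
move=> hj.
have d0 t : j \notin t -> dprod t x h = 0.
  elim: t => //= i t ih; rewrite inE negb_or => /andP[ij jt].
  by rewrite ih // hj 1?eq_sym // mul0mx mulmx0 addr0.
elim: s => [|i s ih] /=.
  by move=> /andP[js _]; rewrite d0 // mulmx0 addr0 /mxprod big_nil mul1mx.
rewrite mem_cat inE !negb_or => /andP[/andP[_ /andP[ij _]] us].
by rewrite hj // mul0mx add0r ih // /mxprod big_cons !mulmxA.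
Qed.

(* With [A], [B] the partial products before and after [M_j], so that [A M_j B = 1],
   the hypothesis says [M_j B Y A = B Y A M_j]. As [Y] commutes with [A], by induction
   on [j], the left-hand side is [Y], hence [Y] commutes with [A M_j] as well. *)
Lemma centralizer_of_annihilator M (Y : 'M[K]_n) :
  mxprod (index_enum 'I_p) M = 1%:M ->
  (forall s j s' X, index_enum 'I_p = s ++ j :: s' ->
    \tr (Y *m (mxprod s M *m (X *m M j - M j *m X) *m mxprod s' M)) = 0) ->
  forall j, Y *m M j = M j *m Y.
Proof.
move=> P1 hY.
have key s j s' : index_enum 'I_p = s ++ j :: s' -> Y *m mxprod s M = mxprod s M *m Y ->
    Y *m mxprod (rcons s j) M = mxprod (rcons s j) M *m Y /\ Y *m M j = M j *m Y.
  move=> es cs; have := hY s j s' ^~ es.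
  have := P1; rewrite es -cat_rcons -cats1 !mxprod_cat mxprod1.
  move: (mxprod s M) (mxprod s' M) (M j) cs => A B m cs ABm tr0.
  have mBA : m *m B *m A = 1%:M by apply: mulmx1C; rewrite mulmxA.
  have e : m *m B *m Y *m A = B *m Y *m A *m m.
    (* Cyclicity of the trace brings [X] to the end, and the trace form is nondegenerate. *)
    apply/subr0_eq/trace_form_inj => X.
    rewrite mulmxBl linearB /= -[RHS](tr0 X) mulmxBr mulmxBl mulmxBr linearB /=.
    congr (_ - _).
      rewrite -!mulmxA (mxtrace_mulC m) -!mulmxA (mxtrace_mulC B) -!mulmxA //.
    by rewrite -!mulmxA (mxtrace_mulC B) -!mulmxA.
  have e1 : B *m Y *m A *m m = Y by rewrite -e -mulmxA cs mulmxA mBA mul1mx.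
  have e2 : Y *m (A *m m) = A *m m *m Y.
    by rewrite -{2}e1 !mulmxA ABm mul1mx.
  (* As [m *m B] inverts [A], it suffices to compare [Y *m m] and [m *m Y] after multiplication by
     [A] on the left. *)
  split=> //; rewrite -[Y *m m]mul1mx -mBA -[m *m Y]mul1mx -mBA -!mulmxA; congr (_ *m (_ *m _)).
  by rewrite !mulmxA -cs -mulmxA e2.
have pre s s' : index_enum 'I_p = s ++ s' -> Y *m mxprod s M = mxprod s M *m Y.
  elim/last_ind: s s' => [|s j ih] s'; first by rewrite /mxprod big_nil mulmx1 mul1mx.
  rewrite cat_rcons => es; have cs := ih _ es.
  by have [] := key _ _ _ es cs.
move=> j; have : j \in index_enum 'I_p by rewrite mem_index_enum.
move=> /(nthP j) [k ks kj].
have es : index_enum 'I_p = take k (index_enum 'I_p) ++ j :: drop k.+1 (index_enum 'I_p).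
  by rewrite -{1}(cat_take_drop k (index_enum 'I_p)) (drop_nth j) // kj.
by have [] := key _ _ _ es (pre _ _ es).
Qed.

End Product.

(** * The variety as a regular zero set *)

Section Fibre.
Variables (R : realType) (n p : nat).
Notation K := R[i].
Hypothesis n_gt0 : (0 < n)%N.
Notation D := (p.+1 * (n * n))%N.

Let i0 : 'I_n := Ordinal n_gt0.
Let e : 'rV[K]_(n * n) := mxvec 1%:M.
(** Coordinates on the matrices modulo the line of scalar ones. *)
Let cb : 'M[K]_(n * n, \rank (cokermx e)) := col_base (cokermx e).
Let s := index_enum 'I_p.+1.

Definition row_proj (j : 'I_p.+1) : 'M[K]_(D, n * n) :=
  lin1_mx (row j \o vec_mx).

Lemma mul_row_proj v j : v *m row_proj j = row j (vec_mx v).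
Proof. by rewrite mul_rV_lin1. Qed.

Lemma mxvec_component (v : 'rV[K]_D) j : mxvec (component v j) = v *m row_proj j.
Proof. by rewrite mul_row_proj vec_mxK. Qed.

Lemma component_tuple_mx (M : 'I_p.+1 -> 'M[K]_n) j : component (mxvec (tuple_mx M)) j = M j.
Proof. by rewrite /component mxvecK rowK mxvecK. Qed.

Lemma tuple_mx_component (T : 'M[K]_(p.+1, n * n)) : tuple_mx (component (mxvec T)) = T.
Proof. by apply/row_matrixP => j; rewrite rowK vec_mxK mxvecK. Qed.

Lemma rank_coker_mxvec1 : \rank (cokermx e) = (n * n - 1)%N.
Proof.
rewrite mxrank_coker rank_rV; congr (_ - _)%N; apply/eqP; rewrite eqb1.
apply/eqP => /(congr1 vec_mx); rewrite mxvecK linear0 => /matrixP /(_ i0 i0).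
by rewrite !mxE eqxx => /eqP; rewrite oner_eq0.
Qed.

Lemma coker_mxvec1P (Z : 'M[K]_n) :
  (mxvec Z - e) *m cb = 0 <-> exists a, Z = a%:M.
Proof.
rewrite mulmx_col_base; split=> [h|[a ->]].
  have /sub_rVP [a ha] : (mxvec Z - e <= e)%MS by rewrite submxE h.
  exists (a + 1); apply: (can_inj mxvecK).
  by rewrite -[LHS](subrK e) ha -[(a + 1)%:M]scalemx1 linearZ /= -/e scalerDl scale1r.
by rewrite -scalemx1 linearZ /= -/e -[X in _ - X]scale1r -scalerBl -scalemxAl mulmx_coker scaler0.
Qed.

(** In a^n - 1 = (a - 1)(1 + a + ... + a^(n-1)) the second factor equals n at [M], hence is nonzero
    nearby. The entry at [i0] reads off a. *)
Lemma prod_scalar_near (M : 'I_p.+1 -> 'M[K]_n) : mxprod s M = 1%:M ->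
  exists2 d : R, 0 < d & forall T : 'M[K]_(p.+1, n * n), nR (T - tuple_mx M) < d ->
    forall a, mxprod s (component (mxvec T)) = a%:M -> a ^+ n = 1 -> a = 1.
Proof.
move=> M1.
pose f (v : 'rV[K]_D) : K := mxprod s (component v) i0 i0.
have sf : smooth1 f.
  apply: (proj1 (smooth_mxP _)) => x; exists (dprod s x); exact: mderiv_mxprod.
have [||d d0 hd] := @smooth1_neq0 _ _ (fun v => \sum_(k < n) f v ^+ k) (mxvec (tuple_mx M)).
- apply: smooth1_sum => k.
  apply: (@smooth1_eq _ _ (fun v => \prod_(i < k) f v)).
    by move=> v; rewrite prodr_const card_ord.
  by apply: smooth1_prod.
- rewrite /f (_ : component _ = M); last by apply/funext => j; rewrite component_tuple_mx.
  rewrite M1 mxE eqxx (eq_bigr (fun _ => 1)) => [|k _]; last by rewrite expr1n.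
  by rewrite sumr_const card_ord pnatr_eq0 -lt0n.
exists d => // T hT a aE an.
have := hd (mxvec T); rewrite -linearB nR_mxvec => /(_ hT).
rewrite /f aE mxE eqxx mulr1n => a0.
have := subrX1 a n; rewrite an subrr => /esym/eqP.
by rewrite mulf_eq0 (negbTE a0) orbF subr_eq0 => /eqP.
Qed.

Lemma det_conjugacy_class (A B : 'M[K]_n) : conjugacy_class A B -> \det B = \det A.
Proof.
move=> [g gu ->]; rewrite !det_mulmx det_inv mulrAC mulfV ?mul1r //.
Qed.

Lemma row_full_leq N q (J : 'M[K]_(N, q)) : row_full J -> (q <= N)%N.
Proof. by move=> /eqP <-; exact: rank_leq_row. Qed.

(** The dimension formula is an addition in [nat], which avoids truncated subtraction. *)
Theorem smooth_at_fibre (C : 'I_p.+1 -> set 'M[K]_n) (M : 'I_p.+1 -> 'M[K]_n) :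
  (forall j, C j = conjugacy_class (M j)) ->
  variety C M -> trivial_centralizer M ->
  exists k : nat,
    (k + n * n = (\sum_(j < p.+1) \rank (intertwiner (M j) (M j))) + 1)%N /\
    smooth_at [set tuple_mx N | N in variety C] (tuple_mx M) k.
Proof.
move=> CE VM ZM.
pose r j := \rank (intertwiner (M j) (M j)).
have rN j : (r j <= n * n)%N by exact: rank_leq_row.
pose q j := (n * n - r j)%N.
(* With the number of equations fixed as [q j] in advance, the chosen maps have types depending on
   [j] alone and can be concatenated. *)
have hq j : exists FJ : ('rV[K]_(n * n) -> 'rV[K]_(q j)) * 'M[K]_(n * n, q j),
  [/\ forall u, exists J', sderiv FJ.1 u J',
      sderiv FJ.1 (mxvec (M j)) FJ.2,
      row_full FJ.2,
      forall X, mxvec (X *m M j - M j *m X) *m FJ.2 = 0 &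
      exists2 d : R, 0 < d & forall B, nR (B - M j) < d ->
        conjugacy_class (M j) B <-> FJ.1 (mxvec B) = 0].
  have [q' [F [J [eq' [FJ FM] Jf Jt hd]]]] := class_equation (M j).
  by move: F J FJ FM Jf Jt hd; rewrite eq' => F J *; exists (F, J).
pose F j := (sval (cid (hq j))).1; pose J j := (sval (cid (hq j))).2.
have FJ j : forall u, exists J', sderiv (F j) u J' by case: (svalP (cid (hq j))).
have FM j : sderiv (F j) (mxvec (M j)) (J j) by case: (svalP (cid (hq j))).
have Jf j : row_full (J j) by case: (svalP (cid (hq j))).
have Jt j : forall X, mxvec (X *m M j - M j *m X) *m J j = 0 by case: (svalP (cid (hq j))).
have Fd j : exists2 d : R, 0 < d & forall B, nR (B - M j) < d ->
    conjugacy_class (M j) B <-> F j (mxvec B) = 0 by case: (svalP (cid (hq j))).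
clearbody F J.
pose m := mxvec (tuple_mx M).
have cm : component m = M by apply/funext => j; exact: component_tuple_mx.
have P1 : mxprod s M = 1%:M by case: VM.
have hP x : exists2 JP, sderiv (fun v => mxvec (mxprod s (component v)) - e) x JP &
    forall h, mxvec (dprod s x h) = h *m JP.
  have hE : mderiv (fun v => mxvec (mxprod s (component v)) - e) x (fun h => mxvec (dprod s x h)).
    have h1 : mderiv (fun v => mxvec (mxprod s (component v))) x (fun h => mxvec (dprod s x h)).
      move=> i j; rewrite ord1; case/mxvec_indexP: j => a b.
      have [Q h1 h2] := mderiv_mxprod s x a b.
      exists Q; first by apply: sderiv1_eq h1 => u; rewrite mxvecE.
      by move=> h; rewrite mxvecE h2.
    apply: mderiv_eq (mderivD h1 (mderiv_cst (- e) x)) => // h; exact: addr0.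
  exact: mderiv_sderiv hE.
pose Phi v := row_mx (\mxrow_j F j (v *m row_proj j))
  ((mxvec (mxprod s (component v)) - e) *m cb).
have PhiJ u : exists J', sderiv Phi u J'.
  have [JP h1 _] := hP u.
  pose J' j := sval (cid (FJ j (u *m row_proj j))).
  have h2 j := sderiv_comp_mulmx (svalP (cid (FJ j (u *m row_proj j)))).
  eexists; exact (sderiv_row_mx (sderiv_mxrow h2) (sderiv_mulmx cb h1)).
have [JP hJP JPE] := hP m.
pose JT := row_mx (\mxrow_j (row_proj j *m J j)) (JP *m cb).
have PhiM : sderiv Phi m JT.
  apply: sderiv_row_mx (sderiv_mulmx cb hJP); apply: sderiv_mxrow => j.
  apply: sderiv_comp_mulmx; rewrite -mxvec_component cm; exact: FM.
have JTf : row_full JT.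
  apply: row_full_inj => w; rewrite -[w]vsubmxK mul_row_col.
  set w1 := usubmx w; set y := dsubmx w; rewrite -[w1]submxcolK mul_mxrow_mxcol => Jw.
  (* The increment that moves only the [j]-th matrix, by [X]. *)
  pose hs j (X : 'M[K]_n) : 'rV[K]_D := mxvec (\matrix_i (if i == j then mxvec X else 0)).
  have hsE j X i : component (hs j X) i = if i == j then X else 0.
    by rewrite /component mxvecK rowK; case: eqP; rewrite ?mxvecK ?linear0.
  have hw j X : mxvec X *m (J j *m submxcol w1 j) + mxvec (dprod s m (hs j X)) *m (cb *m y) = 0.
    have := congr1 (mulmx (hs j X)) Jw; rewrite mulmx0 mulmxDr mulmx_sumr => <-.
    rewrite (bigD1 j) //= big1 => [|i ij].
      by rewrite addr0 JPE !mulmxA -mxvec_component hsE eqxx.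
    by rewrite !mulmxA -mxvec_component hsE (negbTE ij) linear0 !mul0mx.
  have [Y hY] := trace_form (cb *m y).
  have Ycomm : forall j, Y *m M j = M j *m Y.
    apply: centralizer_of_annihilator P1 _ => s1 j s2 X es.
    (* On tangent vectors of the class its own equations have derivative 0 ([Jt]), so the relation
       involves the product alone. *)
    rewrite -hY; have := hw j (X *m M j - M j *m X).
    rewrite mulmxA Jt mul0mx add0r -/s in es *.
    have us : uniq (s1 ++ j :: s2) by rewrite -es index_enum_uniq.
    rewrite es dprod_single //; last by move=> i ij; rewrite hsE (negbTE ij).
    by rewrite cm hsE eqxx => ->; rewrite mxE.
  have [a Ya] := ZM Y Ycomm.
  (* The trace of [Y] is [n] times [a]; it is 0 because [cb] kills the row of the identity, and [n]
     is nonzero in characteristic 0. *)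
  have a0 : a = 0.
    have := hY 1%:M; rewrite mulmx1 Ya mxtrace_scalar mulmxA.
    have -> : mxvec 1%:M *m cb = 0 by apply/mulmx_col_base; exact: mulmx_coker.
    rewrite mul0mx mxE => /esym/eqP; rewrite mulrn_eq0 => /orP[|/eqP //].
    by rewrite -leqn0 leqNgt n_gt0.
  have y0 : y = 0.
    apply: (row_full_mul0 (col_base_full (cokermx e))).
    apply/row_matrixP => i; rewrite row0 rowE; apply/rowP => k; rewrite ord1.
    by rewrite -[delta_mx 0 i]vec_mxK hY Ya a0 -scalemx1 scale0r mul0mx mxtrace0 mxE.
  have w0 j : submxcol w1 j = 0.
    apply: (row_full_mul0 (Jf j)); apply: eq_mxvecmul => X.
    by have := hw j X; rewrite y0 !mulmx0 addr0.
  have w10 : w1 = 0 by apply/mxcolP => j; rewrite w0 submxcol0.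
  by rewrite submxcolK y0 w10 col_mx0.
have SM : [set tuple_mx N | N in variety C] (tuple_mx M) by exists M.
have cT (u : 'rV[K]_D) j : nR (component u j - M j) <= nR (u - m).
  apply: nR_mxle; first exact: nR_ge0.
  move=> a b; apply: le_trans (nR_entry _ 0 (mxvec_index j (mxvec_index a b))).
  by rewrite -[M j]component_tuple_mx -/m /component -!linearB !mxE.
have [d1 d10 hd1] : near2 m (fun u _ => forall j,
    F j (u *m row_proj j) = 0 <-> C j (component u j)).
  apply: near2_forall => j; have [d d0 hd] := Fd j; exists d => // u _ hu _.
  rewrite CE -mxvec_component; have [h1 h2] := hd _ (le_lt_trans (cT u j) hu).
  by split.
have [d2 d20 hd2] := prod_scalar_near P1.
have hS (T : 'M[K]_(p.+1, n * n)) : nR (T - tuple_mx M) < Num.min d1 d2 ->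
    [set tuple_mx N | N in variety C] T <-> Phi (mxvec T) = 0.
  rewrite lt_min => /andP[T1 T2]; set v := mxvec T.
  have FE j : F j (v *m row_proj j) = 0 <-> C j (component v j).
    apply: (hd1 v m); rewrite ?subrr ?nR0 //.
    by rewrite /v /m -linearB nR_mxvec.
  split=> [[N [CN N1] NT]|].
    have vN : component v = N.
      by apply/funext => j; rewrite /v -NT component_tuple_mx.
    rewrite /Phi (_ : \mxrow_j _ = 0); last first.
      by apply/mxrowP => j; rewrite mxrowK submxrow0; apply/FE; rewrite vN.
    rewrite vN (_ : mxprod s N = 1%:M) // subrr mul0mx row_mx0 //.
  rewrite /Phi -[0]hsubmxK => /eq_row_mx [F0 G0].
  have Cv j : C j (component v j).
    apply/FE; have := congr1 (fun Z => submxrow Z j) F0; rewrite mxrowK => ->.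
    by rewrite linear0 submxrow0.
  have [a ha] : exists a, mxprod s (component v) = a%:M.
    by apply/coker_mxvec1P; rewrite G0 linear0.
  have an : a ^+ n = 1.
    rewrite -det_scalar -ha det_mxprod.
    apply: (@etrans _ _ (\prod_(j <- s) \det (M j))); last by rewrite -det_mxprod P1 det1.
    apply: eq_bigr => j _; apply: det_conjugacy_class; rewrite -CE; exact: Cv.
  have a1 := hd2 _ T2 a ha an.
  exists (component v); last exact: tuple_mx_component.
  by split=> //; rewrite a1 in ha; exact: ha.
have d0 : 0 < Num.min d1 d2 by rewrite lt_min d10.
(* Row fullness bounds the number of equations by [D], and [n * n] is positive, so no subtraction
   here truncates. *)
exists (D - (\sum_j q j + \rank (cokermx e)))%N; split.
  have := row_full_leq JTf; rewrite rank_coker_mxvec1 => hle.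
  have qr : (\sum_j q j + \sum_j r j = D)%N.
    rewrite -big_split /= (eq_bigr (fun _ => (n * n)%N)) => [|j _]; last by rewrite subnK.
    by rewrite sum_nat_const card_ord.
  have nn : (0 < n * n)%N by rewrite muln_gt0 n_gt0.
  have arith (a b c z : nat) :
    (a + (c - 1) <= z -> a + b = z -> 0 < c -> z - (a + (c - 1)) + c = b + 1)%N by lia.
  exact: arith hle qr nn.
exact (regular_zero PhiJ PhiM JTf d0 hS SM).
Qed.

End Fibre.

Theorem proposition2 (R : realType) (n p : nat) (hn : (1 <= n)%N)
    (hp : (1 <= p)%N) (C : 'I_p.+1 -> set 'M[R[i]]_n)
    (hC : forall j : 'I_p.+1, is_GL_conjugacy_class (C j))
    (M : 'I_p.+1 -> 'M[R[i]]_n) (hM : variety C M)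
    (hZ : trivial_centralizer M) :
  exists k : nat,
    k%:Z = (\sum_(j < p.+1) (cdim (C j))%:Z) - (n ^ 2)%N%:Z + 1 /\
    smooth_at [set tuple_mx N | N in variety C] (tuple_mx M) k.
Proof.
have CE j : C j = conjugacy_class (M j).
  have [CM _] := hM; have [A _ CA] := hC j.
  by have := CM j; rewrite CA; exact: conjugacy_class_eq.
have [k [kE kS]] := smooth_at_fibre hn CE hM hZ.
exists k; split=> [|]; last exact kS.
have -> : \sum_(j < p.+1) (cdim (C j))%:Z =
    (\sum_(j < p.+1) \rank (intertwiner (M j) (M j)))%N%:Z.
  rewrite (big_morph Posz PoszD (erefl _)); apply: eq_bigr => j _.
  by rewrite CE; congr (_%:Z); exact (cdim_class (M j)).
have arith (a b c : nat) : (c + b = a + 1)%N -> c%:Z = a%:Z - b%:Z + 1 by lia.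
by rewrite -mulnn; exact: arith kE.
Qed.
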